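(* Let $0 < \varepsilon < 1/2$ and let $W\geq 1$ be an integer. Set $\lambda = \frac{\varepsilon}{100W}$. Let $\beta \geq \beta^- + 2$ (with $\beta\geq 3$) be integers such that $\frac{\beta + 6W}{\log(\beta + 6W)} \geq 2 W^2\lambda^{-2}$ and $\beta^- - 6W \geq (1 - \lambda) \cdot (\beta + 6W)$. Let $G$ be an edge-weighted multi-graph with integer edge weights in $\{1,\dots,W\}$ and capacities $\{b_v\}$ (with no bound on the number of parallel edges), and let $\overline{G}$ be its relevant subgraph. Then any $(\beta, \beta^-)$-$w$-$b$-EDCS $H$ of $\overline{G}$ contains a $b$-matching $M_H$ such that $\left(2 - \frac{1}{2W} + \varepsilon\right)\cdot w(M_H) \geq w(M_G)$, where $M_G$ is a maximum weight $b$-matching of $G$.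
   Context: A weighted multi-graph $G=(V,E)$ has a multi-set of weighted edges $(u,v,k)$ with $u\neq v$ and weight $k\in\{1,\dots,W\}$; each vertex $v$ has a positive integer capacity $b_v$; arbitrarily many parallel edges are allowed. The relevant edges between $u$ and $v$ are the $\min(b_u,b_v)$ edges of $G$ between $u$ and $v$ of largest weights (all of them if there are fewer); the relevant subgraph $\overline{G}$ consists of all relevant edges. A $b$-matching is a multi-set $M$ of edges with at most $b_v$ edges of $M$ incident to each $v$; $w(M)$ is its total weight. For a subgraph $H$, $\delta_H(v)$ is the multi-set of edges of $H$ incident to $v$ and $\mathbf{w}\!\deg_H(v)=\sum_{e\in\delta_H(v)}w(e)$. A subgraph $H$ of a multi-graph $F$ is a $(\beta,\beta^-)$-$w$-$b$-EDCS of $F$ if (i) for every edge $(u,v,w_{uv})\in H$, $\frac{\mathbf{w}\!\deg_H(u)}{b_u}+\frac{\mathbf{w}\!\deg_H(v)}{b_v}\leq\beta\cdot w_{uv}$, and (ii) for every edge $(u,v,w_{uv})\in F\setminus H$, $\frac{\mathbf{w}\!\deg_H(u)}{b_u}+\frac{\mathbf{w}\!\deg_H(v)}{b_v}\geq\beta^-\cdot w_{uv}$. *)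

(* Defs.v *)
From HB Require Import structures.
From mathcomp Require Import all_boot all_order all_algebra.
From mathcomp Require Import reals exp.

Set Implicit Arguments.
Unset Strict Implicit.
Unset Printing Implicit Defensive.

Import Order.TTheory GRing.Theory Num.Theory.

Local Open Scope ring_scope.

(* Parallel edges are distinct elements of [edge G]; so sub-multisets of the
   edge multiset, multiset differences and multiplicities become {set edge G},
   set differences and cardinals. *)
Record wmultigraph (V : finType) := WMultigraph {
  edge : finType;
  ends : edge -> {set V};
  weight : edge -> nat;
  card_ends : forall e, #|ends e| = 2
}.

Section Defs.
Variables (V : finType) (G : wmultigraph V).
Implicit Types (u v : V) (e f : edge G) (b : V -> nat) (F H M : {set edge G}).

Definition edges_between u v : {set edge G} :=
  [set e | ends e == [set u; v]].

Definition incident H v : {set edge G} := [set e in H | v \in ends e].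

Definition total_weight M : nat := (\sum_(e in M) weight e)%N.

Definition wdeg H v : nat := total_weight (incident H v).

(* A relation rather than a function: when weights are tied, the heaviest
   min(b_u, b_v) parallel edges are determined only up to exchanging parallel
   edges of equal weight. *)
Definition relevant_subgraph b F : Prop := forall u v,
  #|F :&: edges_between u v| =
    minn (minn (b u) (b v)) #|edges_between u v| /\
  (forall e f, e \in edges_between u v :&: F ->
     f \in edges_between u v :\: F -> (weight f <= weight e)%N).

(* M is a set of edges of G, so no edge is used more often than its
   multiplicity in G. *)
Definition b_matching b M : Prop := forall v, (#|incident M v| <= b v)%N.

Definition max_weight_b_matching b M : Prop :=
  b_matching b M /\
  (forall M', b_matching b M' -> (total_weight M' <= total_weight M)%N).

Definition wb_edcs (R : realFieldType) b (beta betam : int) F H : Prop :=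
  [/\ H \subset F,
      forall e u v, e \in H -> ends e = [set u; v] ->
        (wdeg H u)%:R / (b u)%:R + (wdeg H v)%:R / (b v)%:R
          <= beta%:~R * (weight e)%:R :> R
    & forall e u v, e \in F :\: H -> ends e = [set u; v] ->
        (wdeg H u)%:R / (b u)%:R + (wdeg H v)%:R / (b v)%:R
          >= betam%:~R * (weight e)%:R :> R].

End Defs.

(* Main.v *)
(* A direct primal-dual argument, with a random bipartition by a second moment
   bound in place of the Lovasz local lemma.

   Split every vertex v into b_v slots. The edges of a maximum b-matching M
   inside the relevant subgraph get pairwise disjoint slots, and the edges of
   H \ M are spread so that parallel edges never share a slot and the weighted
   degrees D of the slots of v differ by at most W; the 6W slack absorbs this
   and the removal of M. Up to that slack, H \ M is a simple EDCS for which M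
   is a matching.

   Give random sides to the slots, opposite on each edge of M. As H \ M is
   simple, the crossing degree of a slot s has variance at most W D(s) / 4, so
   it is close to D(s) / 2 for a suitable choice of sides. Egervary's theorem
   yields a matching N of crossing edges of H and an integral cover y with
   total at most w(N).

   Let d be the crossing weighted degree divided by beta / 2, and T the edges of
   M that y does not cover. Let Q be the ends s of T with d(s) > y(s): summing
   d(s) + d(t) <= w(st) over the crossing edges at Q and using Cauchy-Schwarz at
   both ends gives, up to errors,
     Def / (2W) + (2c - 1) Def <= c^2 sum y  for c = 1 - 1 / (2W),
   where Def is the total deficiency of y on T. Integrality of y enters through
   |T| <= Def. Hence Def <= c sum y and w(M) <= sum y + Def <= (1 + c) w(N). *)

Require Import Defs.
From HB Require Import structures.
From mathcomp Require Import all_boot all_order all_algebra.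
From mathcomp Require Import perm zify ring lra.
From mathcomp Require Import reals exp.

Set Implicit Arguments.
Unset Strict Implicit.
Unset Printing Implicit Defensive.

Import Order.TTheory GRing.Theory Num.Theory.

Local Open Scope ring_scope.

(** * Integral duality for weighted bipartite matchings *)

Section Darts.
Variables (S E : finType) (p : E -> bool -> S).

(* The dart [(e, i)] is [e] traversed from [p e i] to its other end. Injectivity
   of [src] on the darts of a matching also excludes loops. *)
Definition src (x : E * bool) : S := p x.1 x.2.
Definition dst (x : E * bool) : S := p x.1 (~~ x.2).
Definition darts (N : {set E}) : {set E * bool} := [set x | x.1 \in N].
Definition matching (N : {set E}) : Prop := {in darts N &, injective src}.

Lemma in_darts (N : {set E}) (x : E * bool) : (x \in darts N) = (x.1 \in N).
Proof. by rewrite inE. Qed.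

Lemma in_darts_rev (N : {set E}) x i : x \in darts N -> (x.1, i) \in darts N.
Proof. by rewrite !in_darts. Qed.

Lemma matching_setU1 (N : {set E}) e : p e true != p e false -> matching N ->
  (forall i x, x \in darts N -> src x != p e i) -> matching (e |: N).
Proof.
move=> neq m miss [f i] [g j]; rewrite !in_darts !inE /= /src /=.
case/predU1P=> [->|fN]; case/predU1P=> [->|gN] H.
- by move: neq H; case: i; case: j => // /eqP nn Heq; case: nn; rewrite Heq.
- by have := miss i (g, j); rewrite in_darts /src /= H eqxx => /(_ gN).
- by have := miss j (f, i); rewrite in_darts /src /= H eqxx => /(_ fN).
- by apply: m; rewrite ?in_darts.
Qed.

(** * Exchanging two matchings along an alternating component *)

Section Exchange.
Variables (side : S -> bool) (N N' : {set E}) (u v : S).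
Hypotheses (mN : matching N) (mN' : matching N').
Hypothesis bip : forall e, e \in N :|: N' -> side (p e true) != side (p e false).
Hypothesis Nu : forall x, x \in darts N -> src x != u.
Hypothesis N'v : forall x, x \in darts N' -> src x != v.
Hypothesis suv : side u != side v.

(** A step follows an edge of [N'] and then one of [N], so it preserves the side. [PA] is the half
    of the alternating component of [u] on the side of [u], and [P] adds its [N']-neighbours. *)
Let step (a a' : S) := [exists x in darts N', exists y in darts N,
  [&& src x == a, dst x == src y & dst y == a']].
Let PA := [set s | connect step u s].
Let P := PA :|: [set dst x | x in darts N' & src x \in PA].

Let bip_dart x : x.1 \in N :|: N' -> side (dst x) = ~~ side (src x).
Proof.
move=> /bip; rewrite /src /dst; case: x => e [] /=; by case: (side _); case: (side _).
Qed.

Let step_side a a' : step a a' -> side a = side a'.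
Proof.
case/exists_inP=> x xN' /exists_inP[y yN] /and3P[/eqP <- /eqP xy /eqP <-].
rewrite in_darts in xN'; rewrite in_darts in yN.
have := @bip_dart x; rewrite inE xN' orbT xy => /(_ isT) h1.
by have := @bip_dart y; rewrite inE yN h1 negbK => /(_ isT) ->.
Qed.

Let PA_side s : s \in PA -> side s = side u.
Proof.
rewrite inE => /connectP[q]; elim: q u => [|a q IH] z /=; first by move=> _ ->.
by case/andP=> /step_side -> /IH h /h.
Qed.

(** A vertex of [PA] reached by a step was entered through an edge of [N]; as [N] is a matching, its
    dart leads back to an [N']-neighbour of [PA]. The start [u] has no dart in [N]. *)
Let PA_N s y : s \in PA -> y \in darts N -> src y = s -> dst y \in P.
Proof.
rewrite inE => /connectP[q].
case/lastP: q => [|q z] /=; first by move=> _ -> /Nu /eqP.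
rewrite last_rcons rcons_path => /andP[pq stz] -> yN sy.
case/exists_inP: stz => x xN' /exists_inP[y' yN'] /and3P[/eqP sx /eqP xy /eqP dy].
have Ey : y = (y'.1, ~~ y'.2).
  apply: mN (in_darts_rev _ yN') _ => //.
  by rewrite sy -dy.
rewrite inE; apply/orP; right; apply/imsetP; exists x.
  rewrite inE xN' sx inE; apply/connectP; by exists q.
by rewrite xy Ey /dst /= negbK.
Qed.

Let closedN y : y \in darts N -> src y \in P -> dst y \in P.
Proof.
move=> yN; rewrite inE => /orP[h|]; first exact: PA_N h yN erefl.
case/imsetP=> x; rewrite inE => /andP[xN' xP] sy.
rewrite inE; apply/orP; left; move: xP; rewrite !inE => xP.
apply: connect_trans xP _; apply: connect1; apply/exists_inP; exists x => //.
by apply/exists_inP; exists y; rewrite // !eqxx -sy eqxx.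
Qed.

Let closedN' y : y \in darts N' -> src y \in P -> dst y \in P.
Proof.
move=> yN'; rewrite inE => /orP[h|].
  by rewrite inE; apply/orP; right; apply/imsetP; exists y; rewrite // inE yN'.
case/imsetP=> x; rewrite inE => /andP[xN' xP] sy.
have -> : y = (x.1, ~~ x.2).
  by apply: mN' (in_darts_rev _ xN') sy.
by rewrite inE /dst /= negbK -/(src x) xP.
Qed.

Let touch e := p e true \in P.

Let touchE e i : e \in N :|: N' -> (p e i \in P) = touch e.
Proof.
rewrite /touch; case: i => //= eN; apply/idP/idP => h.
- case/setUP: eN => eN; first by have := @closedN (e, false); rewrite in_darts; apply.
  by have := @closedN' (e, false); rewrite in_darts; apply.
- case/setUP: eN => eN; first by have := @closedN (e, true); rewrite in_darts; apply.
  by have := @closedN' (e, true); rewrite in_darts; apply.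
Qed.

Let uP : u \in P.
Proof. by rewrite !inE connect0. Qed.

(** Sides keep [v] out of [PA], and [N'] misses [v], so [v] is no [N']-neighbour either. *)
Let vP : v \notin P.
Proof.
rewrite inE negb_or; apply/andP; split.
  by apply/negP => /PA_side h; move: suv; rewrite h eqxx.
apply/imsetP => -[x]; rewrite inE => /andP[xN' _] vE.
by have := N'v (in_darts_rev (~~ x.2) xN'); rewrite /src -/(dst x) -vE eqxx.
Qed.

(* Both exchanges along the alternating component [P] of [u] are returned, so
   that the caller can argue that neither is heavier than a maximum. *)
Lemma exchange : exists N1 N2 : {set E},
  [/\ matching N1, matching N2, N1 :|: N2 = N :|: N', N1 :&: N2 = N :&: N' &
    forall x, x \in darts N1 -> (src x != u) && (src x != v)].
Proof.
(* [N1] follows [N] inside [P] and [N'] outside: [N] misses [u], which lies in [P], and [N'] misses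
   [v], which does not. *)
pose N1 := [set e in N | touch e] :|: [set e in N' | ~~ touch e].
pose N2 := [set e in N' | touch e] :|: [set e in N | ~~ touch e].
have gen (A C : {set E}) : matching A -> matching C -> A :|: C = N :|: N' ->
    matching ([set e in A | touch e] :|: [set e in C | ~~ touch e]).
  move=> mA mC AC x y; rewrite !in_darts !inE => hx hy sxy.
  have xt : x.1 \in N :|: N' by rewrite -AC inE; case/orP: hx => /andP[->]; rewrite ?orbT.
  have yt : y.1 \in N :|: N' by rewrite -AC inE; case/orP: hy => /andP[->]; rewrite ?orbT.
  have txy : touch x.1 = touch y.1.
    by rewrite -(touchE x.2 xt) -(touchE y.2 yt) -!/(src _) sxy.
  move: hx hy; rewrite -txy; case: (touch x.1); rewrite ?andbT ?andbF ?orbF /= => xA yA.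
    by apply: mA; rewrite ?in_darts.
  by apply: mC; rewrite ?in_darts.
exists N1, N2; split.
- exact: gen.
- by apply: gen => //; rewrite setUC.
- by apply/setP => e; rewrite !inE; case: (touch e); case: (e \in N); case: (e \in N').
- by apply/setP => e; rewrite !inE; case: (touch e); case: (e \in N); case: (e \in N').
- move=> x; rewrite in_darts inE => /orP[]; rewrite inE => /andP[xN tx].
    rewrite Nu ?in_darts //=; apply/eqP => sv; move/negP: vP; apply.
    by rewrite -sv /src touchE // inE xN.
  rewrite N'v ?in_darts // andbT; apply/eqP => su; move/negP: tx; apply.
  by rewrite -(touchE x.2) -?/(src x) ?su // inE xN orbT.
Qed.
End Exchange.

Variable side : S -> bool.
Implicit Type w : E -> nat.

Definition weight_matching w (N : {set E}) : bool :=
  dinjectiveb src (darts N) && [forall e in N, 0 < w e]%N.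

Lemma weight_matchingP w N :
  reflect (matching N /\ forall e, e \in N -> (0 < w e)%N) (weight_matching w N).
Proof.
apply: (iffP andP) => -[h1 h2]; split.
- exact/dinjectiveP.
- by move=> e eN; move/forall_inP: h2; apply.
- exact/dinjectiveP.
- exact/forall_inP.
Qed.

Lemma weight_matching0 w : weight_matching w set0.
Proof. by apply/weight_matchingP; split=> [x|e]; rewrite ?in_darts inE. Qed.

Definition max_matching w (N : {set E}) : Prop := weight_matching w N /\
  forall N', weight_matching w N' -> (\sum_(e in N') w e <= \sum_(e in N) w e)%N.

(** If one maximum matching missed the first end of [e] and another the second, exchanging them
    would give [N1] missing both ends; then [e |: N1] and [N2] together would outweigh two maximum
    matchings by [w e]. *)
Lemma essential_end w e :
  (forall f, (0 < w f)%N -> side (p f true) != side (p f false)) -> (0 < w e)%N ->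
  exists i, forall N, max_matching w N -> exists2 x, x \in darts N & src x = p e i.
Proof.
move=> bip we.
pose cov N i := [exists x in darts N, src x == p e i].
pose mx N := weight_matching w N &&
  [forall N' : {set E}, weight_matching w N' ==> (\sum_(f in N') w f <= \sum_(f in N) w f)%N].
have mxP N : reflect (max_matching w N) (mx N).
  apply: (iffP andP) => -[h1 h2]; split => //.
    by move=> N' h'; have /implyP := forallP h2 N'; apply.
  by apply/forallP => N'; apply/implyP; apply: h2.
have covP N i : reflect (exists2 x, x \in darts N & src x = p e i) (cov N i).
  by apply: (iffP exists_inP) => -[x h /eqP h']; exists x => //; apply/eqP.
case: (boolP [forall N : {set E}, mx N ==> cov N true]) => [/forallP h|].
  by exists true => N /mxP hN; apply/covP; have /implyP := h N; apply.
rewrite negb_forall => /existsP[N]; rewrite negb_imply => /andP[/mxP [/weight_matchingP[mN wN] xN] cN].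
exists false => N' /mxP hN'; apply/covP; apply: contraT => cN'.
move/mxP: hN' => [/weight_matchingP[mN' wN'] xN'].
have [||||N1 [N2 [m1 m2 U I miss]]] := @exchange side N N' (p e true) (p e false) mN mN'.
- by move=> f /setUP[/wN|/wN'] /bip.
- by move=> x xd; apply: contra cN => sx; apply/exists_inP; exists x.
- by move=> x xd; apply: contra cN' => sx; apply/exists_inP; exists x.
- exact: bip.
have eN1 : e \notin N1.
  by apply/negP => h; have := miss (e, true); rewrite in_darts h /src /= eqxx => /(_ isT).
have N12 f : f \in N1 :|: N2 -> (0 < w f)%N by rewrite U => /setUP[/wN|/wN'].
have sumE (A C : {set E}) : (\sum_(f in A) w f + \sum_(f in C) w f =
    \sum_(f in A :|: C) w f + \sum_(f in A :&: C) w f)%N.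
  rewrite (big_setID A (A := A :|: C)) /= setUK setDUl setDv set0U.
  rewrite [X in (_ + X = _)%N](big_setID A) /= (setIC C A); lia.
have h2 : weight_matching w N2.
  by apply/weight_matchingP; split=> // f fN; apply: N12; rewrite inE fN orbT.
have h1 : weight_matching w (e |: N1).
  apply/weight_matchingP; split=> [|f].
    apply: matching_setU1 => //; first by apply: contraNneq (bip e we) => ->.
    by move=> i x /miss /andP[]; case: i.
  by case/setU1P=> [->|fN] //; apply: N12; rewrite inE fN.
have := xN _ h2; have := xN' _ h1; rewrite big_setU1 //=.
have := sumE N1 N2; rewrite U I -sumE; lia.
Qed.

(** Induction on the total weight: lower by one the weights at an end met by every maximum matching,
    and raise the cover there by one. The maximum drops by at least one, which pays for the
    raise. *)
Lemma egervary w :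
  (forall e, (0 < w e)%N -> side (p e true) != side (p e false)) ->
  exists (N : {set E}) (y : S -> nat),
    [/\ matching N, forall e, e \in N -> (0 < w e)%N,
        forall e, (w e <= y (p e true) + y (p e false))%N
      & (\sum_s y s <= \sum_(e in N) w e)%N].
Proof.
have [m] := ubnP (\sum_e w e)%N; elim: m w => // m IH w lt_m bip.
case: (boolP [exists e, 0 < w e]%N); last first.
  rewrite negb_exists => /forallP h; exists set0, (fun=> 0%N); split.
  - by move=> x; rewrite in_darts inE.
  - by move=> e; rewrite inE.
  - by move=> e; move: (h e); rewrite -leqNgt.
  - by rewrite sum_nat_const muln0.
case/existsP=> e we; have [i ess] := essential_end bip we.
pose at_ f := [exists j, p f j == p e i].
pose w' f := (w f - at_ f)%N.
have w'w f : (w' f <= w f)%N by rewrite leq_subr.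
have ate : at_ e by apply/existsP; exists i.
have [||N' [y [mN' wN' cov yN']]] := IH w'.
- have -> : (\sum_f w' f = (w e).-1 + \sum_(f | f != e) w' f)%N.
    by rewrite (bigD1 e) //= /w' ate subn1.
  move: lt_m; rewrite (bigD1 e) //=.
  have : (\sum_(f | f != e) w' f <= \sum_(f | f != e) w f)%N by apply: leq_sum.
  lia.
- by move=> f h; apply: bip; apply: leq_trans h _.
have [N /[dup] hN [wmN xN]] : exists N, max_matching w N.
  have [/= N hN hmax] := @arg_maxnP _ set0 (weight_matching w)
     (fun N : {set E} => \sum_(e in N) w e)%N (weight_matching0 w).
  by exists N; split.
have wm' : weight_matching w N'.
  by apply/weight_matchingP; split=> // f /wN' h; apply: leq_trans h _.
have le_w' : (\sum_(f in N') w' f <= \sum_(f in N') w f)%N by apply: leq_sum.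
(* Either [N'] is not maximum for [w], or it meets the chosen end and its edge there has lost a
   unit. *)
have gain : (\sum_(f in N') w' f < \sum_(f in N) w f)%N.
  have := xN _ wm'; rewrite leq_eqVlt => /orP[/eqP eqN|]; last exact: leq_ltn_trans.
  have [|x xN' sx] := ess N'; first by split=> // A /xN; rewrite eqN.
  rewrite in_darts in xN'; rewrite -eqN (bigD1 x.1) //= [X in (_ < X)%N](bigD1 x.1) //=.
  have : (\sum_(f in N' | f != x.1) w' f <= \sum_(f in N' | f != x.1) w f)%N.
    by apply: leq_sum.
  have : (w' x.1 < w x.1)%N.
    have /weight_matchingP[_ /(_ _ xN')] := wm'; rewrite /w'.
    have -> : at_ x.1 by apply/existsP; exists x.2; rewrite -/(src x) sx.
    by case: (w x.1) => // z _; rewrite subn1.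
  by move=> h1 h2; rewrite -addSn; apply: leq_add.
exists N, (fun s => y s + (s == p e i))%N; split.
- by case/weight_matchingP: wmN.
- by case/weight_matchingP: wmN.
- move=> f; have := cov f; rewrite /w' leq_subLR => /leq_trans; apply.
  rewrite addnACA [X in (_ <= X)%N]addnC leq_add2r.
  case: (boolP (at_ f)) => //= /existsP[[] ->] //; by rewrite addn1.
- rewrite big_split /= (bigD1 (p e i) (F := fun s => nat_of_bool _)) //= eqxx.
  rewrite [X in (_ + (_ + X))%N]big1 => [|s ns]; last by rewrite (negPf ns).
  by rewrite addn0 addn1; apply: leq_ltn_trans yN' gain.
Qed.
End Darts.

(** * Choice of the sides *)

Lemma exists_le_mean (R : realFieldType) (T : finType) (F : T -> R) (B : R) :
  (0 < #|T|)%N -> \sum_t F t <= #|T|%:R * B -> exists t, F t <= B.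
Proof.
move=> T0 le; apply/existsP; apply: contraT; rewrite negb_exists => /forallP h.
suff : #|T|%:R * B < \sum_t F t by rewrite ltNge le.
have -> : #|T|%:R * B = \sum_(t : T) B by rewrite sumr_const mulr_natl.
case/card_gt0P: T0 => t0 _.
rewrite (bigD1 t0) //= [X in _ < X](bigD1 t0) //=; apply: ltr_leD.
  by rewrite ltNge h.
by apply: ler_sum => t _; apply: ltW; rewrite ltNge h.
Qed.

Section Sides.
Variables (R : realFieldType) (S E : finType) (p : E -> bool -> S).
Variables (M H0 : {set E}) (k : E -> nat) (omega : S -> R).
Hypothesis mM : matching p M.
Hypothesis simpleH : {in darts H0 &, forall x y, src p x = src p y -> dst p x = dst p y -> x = y}.
Hypothesis omega_ge0 : forall s, 0 <= omega s.

(** The two ends of an edge of [M] share one random bit: [rep] sends the [false] end to the [true]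
    end, and [neg] records that the bit is negated there. *)
Let second (s : S) := [pick x in darts M | (src p x == s) && ~~ x.2].
Let rep (s : S) : S := if second s is Some x then dst p x else s.
Let neg (s : S) : bool := second s != None.
Let side_of (t : {ffun S -> bool}) (s : S) : bool := t (rep s) (+) neg s.

Let secondP s x : second s = Some x -> [/\ x \in darts M, src p x = s & x.2 = false].
Proof.
by rewrite /second; case: pickP => // y /andP[yM /andP[/eqP sy ny]] [<-]; split=> //; case: (y.2) ny.
Qed.

Let second_false e : e \in M -> second (p e false) = Some (e, false).
Proof.
move=> eM; rewrite /second; case: pickP => [x /andP[xM /andP[/eqP sx _]]|].
  by congr Some; apply: (mM xM); rewrite ?in_darts.
by move/(_ (e, false)); rewrite in_darts eM /src /= eqxx.
Qed.

Let second_true e : e \in M -> second (p e true) = None.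
Proof.
move=> eM; rewrite /second; case: pickP => [x /andP[xM /andP[/eqP sx nx]]|//].
have xE : x = (e, true) by apply: (mM xM); rewrite ?in_darts.
by rewrite xE in nx.
Qed.

Let side_M t e : e \in M -> side_of t (p e true) != side_of t (p e false).
Proof.
move=> eM; rewrite /side_of /rep /neg second_false // second_true // /dst /=.
by case: (t _).
Qed.

Let rep_inj s s' : rep s = rep s' -> neg s = neg s' -> s = s'.
Proof.
rewrite /rep /neg; case E1: (second s) => [x|]; case E2: (second s') => [x'|] //=.
case/secondP: E1 => xM <- x2; case/secondP: E2 => x'M <- x'2 dd _.
have := mM (in_darts_rev (~~ x.2) xM) (in_darts_rev (~~ x'.2) x'M) dd.
by move=> [exx _]; rewrite /src exx x2 x'2.
Qed.

(* Distinct vertices get either independent or opposite sides. *)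
Let sum_sides s s' :
  \sum_t ((-1) ^+ side_of t s * (-1) ^+ side_of t s') <=
    (s == s')%:R * #|{ffun S -> bool}|%:R :> R.
Proof.
case: eqVneq => [<-|ns].
  rewrite mul1r -sum1_card natr_sum; apply: ler_sum => t _.
  by rewrite -expr2 sqrr_sign.
rewrite mul0r; case: (eqVneq (rep s) (rep s')) => [rr|nr].
  apply: sumr_le0 => t _; rewrite -signr_addb /side_of rr.
  have : neg s != neg s' by apply: contraNneq ns => nn; apply/eqP/rep_inj.
  by case: (t _); case: (neg s); case: (neg s') => //= _; rewrite expr1 lerN10.
(* Flipping the bit at [rep s] negates every summand, since [s'] reads another bit; so the sum
   equals its opposite. *)
pose fl (t : {ffun S -> bool}) := [ffun a => t a (+) (a == rep s)].
have flK : involutive fl by move=> t; apply/ffunP => a; rewrite !ffunE addbK.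
set X := \sum_t _; suff : X = - X by move=> XE; lra.
rewrite {1}/X (reindex_inj (inv_inj flK)) -sumrN; apply: eq_bigr => t _.
rewrite -!signr_addb /side_of !ffunE eqxx [rep s' == _]eq_sym (negPf nr) addbF.
by case: (t (rep s)); case: (t _); case: (neg s); case: (neg _); rewrite /= ?expr1 ?expr0 ?opprK.
Qed.

(** Expand the square and average over all [t]. By simplicity, distinct darts out of [s] have
    distinct far ends, so the off-diagonal terms are nonpositive; some [t] is no worse than the
    mean. *)
Lemma balanced_sides : exists side : S -> bool,
  (forall e, e \in M -> side (p e true) != side (p e false)) /\
  \sum_s omega s * (\sum_(x in darts H0 | src p x == s) (-1) ^+ side (dst p x) * (k x.1)%:R) ^+ 2
   <= \sum_s omega s * \sum_(x in darts H0 | src p x == s) (k x.1)%:R ^+ 2.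
Proof.
pose B := \sum_s omega s * \sum_(x in darts H0 | src p x == s) (k x.1)%:R ^+ 2.
pose F (t : {ffun S -> bool}) := \sum_s omega s *
  (\sum_(x in darts H0 | src p x == s) (-1) ^+ side_of t (dst p x) * (k x.1)%:R) ^+ 2.
suff [t Ft] : exists t, F t <= B.
  by exists (side_of t); split=> // e; apply: side_M.
apply: exists_le_mean; first by apply/card_gt0P; exists [ffun=> true].
rewrite exchange_big mulr_sumr; apply: ler_sum => s _.
rewrite -mulr_sumr mulrCA; apply: ler_wpM2l => //.
under eq_bigr => t _.
  rewrite expr2 big_distrlr /=.
  under eq_bigr => x _ do under eq_bigr => y _ do rewrite mulrACA.
  over.
rewrite /= exchange_big mulr_sumr /=; apply: ler_sum => x /andP[xH /eqP sx].
rewrite exchange_big /=; under eq_bigr => y _ do rewrite -mulr_suml.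
apply: le_trans (_ : \sum_(y in darts H0 | src p y == s)
    ((dst p x == dst p y)%:R * #|{ffun S -> bool}|%:R) * ((k x.1)%:R * (k y.1)%:R) <= _).
  by apply: ler_sum => y _; apply: ler_wpM2r => //; rewrite mulr_ge0 ?ler0n.
rewrite (bigD1 x) ?xH ?sx ?eqxx //= mul1r big1 ?addr0 ?expr2 //.
move=> y /andP[/andP[yH /eqP sy] nyx]; case: eqVneq => [dd|]; last by rewrite !mul0r.
by move: nyx; rewrite (simpleH yH xH) ?eqxx ?sx ?sy.
Qed.
End Sides.

(** * Counting against an integral cover *)

Section DartSums.
Variables (R : realFieldType) (S E : finType) (p : E -> bool -> S).

Lemma sum_darts (A : {set E}) (F : E * bool -> R) :
  \sum_(x in darts A) F x = \sum_(e in A) (F (e, true) + F (e, false)).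
Proof.
under [RHS]eq_bigr => e _ do rewrite -(big_bool _ (fun i => F (e, i))).
rewrite pair_big /=; apply: eq_big => [x|x _]; first by rewrite in_darts andbT.
by case: x.
Qed.

Lemma sum_fiber (T : finType) (f : T -> S) (P : pred T) (Q : pred S) (F : T -> R) :
  \sum_(x | P x && Q (f x)) F x = \sum_(s | Q s) \sum_(x | P x && (f x == s)) F x.
Proof.
rewrite (partition_big f Q) /=; last by move=> x /andP[].
apply: eq_bigr => s Qs; apply: eq_bigl => x; rewrite -andbA; congr (_ && _).
by case: eqVneq => [->|]; rewrite ?Qs ?andbF.
Qed.

Lemma sum_darts_rev (A : {set E}) (P : pred (E * bool)) (F : E * bool -> R) :
  \sum_(x in darts A | P x) F x =
  \sum_(x in darts A | P (x.1, ~~ x.2)) F (x.1, ~~ x.2).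
Proof.
rewrite (reindex_inj (inv_inj (f := fun x : E * bool => (x.1, ~~ x.2)) _)) /=.
  by apply: eq_bigl => x; rewrite !in_darts.
by case=> e i /=; rewrite negbK.
Qed.

Lemma sum_matching_le (A : {set E}) (P : pred (E * bool)) (f : S -> R) :
  matching p A -> (forall s, 0 <= f s) ->
  \sum_(x in darts A | P x) f (src p x) <= \sum_s f s.
Proof.
move=> mA f0; have inj : {in [set x in darts A | P x] &, injective (src p)}.
  by move=> x x'; rewrite ![_ \in [set x in _ | _]]inE => /andP[xA _] /andP[x'A _]; apply: mA.
have <- : \sum_(s in [set src p x | x in [set x in darts A | P x]]) f s =
    \sum_(x in darts A | P x) f (src p x).
  by rewrite big_imset //=; apply: eq_bigl => x; rewrite !inE.
by rewrite [X in _ <= X](bigID (mem [set src p x | x in [set x in darts A | P x]])) /= lerDl sumr_ge0.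
Qed.
End DartSums.

(** For [A > 0] this combines [A * A <= a * y * d] with [(A - c * y) ^+ 2 >= 0]. The tangent of
    [A ^+ 2 / y] stands in for the quotient, so that the bound can be summed and also covers
    [y = 0]. *)
Lemma cauchy_linearized (R : realFieldType) (a A d y c : R) :
  0 <= a -> 0 <= y -> 0 <= c -> 0 <= d -> A <= a * y -> A <= d ->
  2 * c * A - c ^+ 2 * y <= a * d.
Proof.
move=> a0 y0 c0 d0 Aay Ad; have [A0|A0] := lerP A 0.
  have : 0 <= a * d by rewrite mulr_ge0.
  have : 0 <= c ^+ 2 * y by rewrite mulr_ge0 ?sqr_ge0.
  have : c * A <= 0 by rewrite mulr_ge0_le0.
  lra.
have yp : 0 < y.
  by rewrite lt0r y0 andbT; apply: contraTneq (lt_le_trans A0 Aay) => ->; rewrite mulr0 ltxx.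
rewrite -subr_ge0 -(pmulr_rge0 _ yp).
have : A * A <= a * y * d by apply: ler_pM => //; apply: ltW.
have : 0 <= (A - c * y) ^+ 2 by rewrite sqr_ge0.
nra.
Qed.

Section Counting.
Variables (R : realFieldType) (S E : finType) (p : E -> bool -> S).
Variables (M H' H1 : {set E}) (k : E -> nat) (W : nat) (xi lam : R).
Variables (y : S -> nat) (eta : S -> R).

Let d s : R := \sum_(x in darts H' | src p x == s) xi * (k x.1)%:R.
Let n s : R := \sum_(x in darts H' | src p x == s) xi.

Hypothesis W_gt0 : (0 < W)%N.
Hypothesis k_bounds : forall e, (1 <= k e <= W)%N.
Hypothesis mM : matching p M.
Hypothesis xi_ge0 : 0 <= xi.
Hypothesis lam_ge0 : 0 <= lam.
Hypothesis eta_ge0 : forall s, 0 <= eta s.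
Hypothesis upper : forall x, x \in darts H' ->
  d (src p x) + d (dst p x) <= (k x.1)%:R + eta (src p x) + eta (dst p x).
Hypothesis n_le : forall s, n s <= 1 + eta s.
Hypothesis lower : forall e, e \in M :\: H1 ->
  (1 - lam) * (k e)%:R - eta (p e true) - eta (p e false) <= d (p e true) + d (p e false).
Hypothesis cover : forall e, e \in H' :|: H1 -> (k e <= y (p e true) + y (p e false))%N.

(** This value minimises [c ^+ 2 / (2 * c - 1 + 1 / (2 * W%:R))], the ratio of [Def] to [Y] that the
    counting yields, and the minimum is [c] itself. *)
Let c : R := 1 - 1 / (2 * W%:R).
Let Y : R := \sum_s (y s)%:R.
Let T := [set e in M | y (p e true) + y (p e false) < k e]%N.
Let g s := d s - (y s)%:R.
Let QD := [set x in darts T | 0 < g (src p x)].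
Let Q := [set src p x | x in QD].
Let Def : R := \sum_(e in T) ((k e)%:R - (y (p e true))%:R - (y (p e false))%:R).
Let E1 : R := lam * \sum_(e in M) (k e)%:R + \sum_(x in darts M) eta (src p x).
Let EM : R := \sum_(x in darts M) eta (src p x).
Let En : R := \sum_s n s * eta s.
Let D2 : R := \sum_(x in darts H' | src p x \in Q) xi * ((k x.1)%:R - (y (src p x))%:R).

Let W1 : 1 <= W%:R :> R. Proof. by rewrite ler1n. Qed.
Let TM : T \subset M. Proof. by apply/subsetP => e; rewrite inE => /andP[]. Qed.
Let d_ge0 s : 0 <= d s.
Proof. by apply: sumr_ge0 => x _; rewrite mulr_ge0 ?ler0n. Qed.
Let n_ge0 s : 0 <= n s.
Proof. by apply: sumr_ge0. Qed.

Let QD_inj : {in QD &, injective (src p)}.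
Proof.
move=> x x'; rewrite !inE => /andP[/andP[xM _] _] /andP[/andP[x'M _] _].
by apply: mM; rewrite in_darts.
Qed.

Let sumQ (f : S -> R) : \sum_(s in Q) f s = \sum_(x in QD) f (src p x).
Proof. by rewrite /Q big_imset. Qed.

Let Q_gt0 s : s \in Q -> 0 < g s.
Proof. by case/imsetP=> x; rewrite inE => /andP[_ gx] ->. Qed.

Let Q_y s : s \in Q -> (y s <= W)%N.
Proof.
case/imsetP=> -[e i]; rewrite !inE => /andP[/andP[_ yk] _] -> /=.
have /andP[_ kW] := k_bounds e; apply: leq_trans kW; apply: leq_trans (ltnW yk).
by rewrite /src /=; case: (i); rewrite ?leq_addr ?leq_addl.
Qed.

Let weight_le : \sum_(e in M) (k e)%:R <= Y + Def.
Proof.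
have YM : \sum_(e in M) ((y (p e true))%:R + (y (p e false))%:R) <= Y :> R.
  have := @sum_matching_le R _ _ p M predT (fun s => (y s)%:R) mM (fun s => ler0n _ _).
  rewrite (eq_bigl (fun x => x \in darts M)) => [|x]; last by rewrite andbT.
  by rewrite sum_darts.
have -> : Def = \sum_(e in M) (if e \in T then (k e)%:R - (y (p e true))%:R - (y (p e false))%:R else 0).
  rewrite -big_mkcondr; apply: eq_bigl => e.
  by rewrite -in_setI (setIidPr TM).
apply: le_trans (lerD YM (lexx _)); rewrite -big_split; apply: ler_sum => e eM /=.
rewrite inE eM /=; case: ltnP => h; first by lra.
by rewrite addr0 -natrD ler_nat.
Qed.

(** An edge of [T] is uncovered, hence not in [H1], so [lower] bounds the sum of [g] at its ends
    from below. Dropping the ends with [g <= 0] only increases the total. *)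
Let gain_lower : Def - E1 <= \sum_(s in Q) g s.
Proof.
have h1 : \sum_(x in darts T) g (src p x) <= \sum_(s in Q) g s.
  rewrite sumQ [X in _ <= X](eq_bigl (fun x => (x \in darts T) && (0 < g (src p x)))).
    rewrite big_mkcondr; apply: ler_sum => x _; case: ltP => //.
  by move=> x; rewrite inE.
apply: le_trans h1; rewrite sum_darts.
have eT : \sum_(e in T) (eta (p e true) + eta (p e false)) <= EM.
  rewrite /EM sum_darts [X in _ <= X](big_setID T) /= (setIidPr TM) lerDl.
  by apply: sumr_ge0 => e _; rewrite addr_ge0.
have kT : lam * \sum_(e in T) (k e)%:R <= lam * \sum_(e in M) (k e)%:R.
  apply: ler_wpM2l => //; rewrite [X in _ <= X](big_setID T) /= (setIidPr TM) lerDl.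
  exact: sumr_ge0.
suff : Def - lam * \sum_(e in T) (k e)%:R - \sum_(e in T) (eta (p e true) + eta (p e false))
    <= \sum_(e in T) (g (p e true) + g (p e false)).
  by move: eT kT; rewrite /E1 -/EM; lra.
rewrite mulr_sumr -!sumrB; apply: ler_sum => e eT' /=.
have : e \in M :\: H1.
  move: eT'; rewrite !inE => /andP[-> yk]; rewrite andbT; apply: contraL yk => eH1.
  by rewrite -leqNgt cover // inE eH1 orbT.
by move/lower; rewrite /g; lra.
Qed.

(** By integrality every edge of [T] has deficiency at least one, and it contributes at most two
    vertices to [Q]. *)
Let cardQ : #|Q|%:R <= 2 * Def.
Proof.
have : (#|Q| <= #|darts T|)%N.
  apply: leq_trans (leq_imset_card _ _) _; apply: subset_leq_card.
  by apply/subsetP => x; rewrite inE => /andP[].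
rewrite -(ler_nat R) => /le_trans; apply.
rewrite -sum1_card natr_sum sum_darts /Def mulr_sumr; apply: ler_sum => e.
rewrite inE => /andP[_]; rewrite -(ler_nat R) -addn1 !natrD; lra.
Qed.

(** As weights are at most [W], [n s * W%:R >= d s >= g s]; the resulting square is made linear by
    [g ^+ 2 >= g - 1 / 4]. *)
Let first_part : (\sum_(s in Q) g s - #|Q|%:R / 4) / W%:R <= \sum_(s in Q) n s * g s.
Proof.
have -> : #|Q|%:R / 4 = \sum_(s in Q) (1 / 4) :> R by rewrite sumr_const mul1r mulr_natl.
rewrite -sumrB mulr_suml; apply: ler_sum => s sQ.
have w1 := W1; have gs := Q_gt0 sQ; rewrite ler_pdivrMr; last by lra.
have dn : d s <= n s * W%:R.
  rewrite /d /n mulr_suml; apply: ler_sum => x _; apply: ler_wpM2l => //.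
  by rewrite ler_nat; case/andP: (k_bounds x.1).
have y0 : 0 <= (y s)%:R :> R by [].
have : g s * g s <= n s * W%:R * g s.
  by apply: ler_wpM2r; [exact: ltW | apply: le_trans dn; rewrite /g lerBlDr lerDl].
have : 0 <= (g s - 1 / 2) ^+ 2 by rewrite sqr_ge0.
nra.
Qed.

Let D2E : D2 = \sum_(s in Q) (d s - n s * (y s)%:R).
Proof.
rewrite /D2 sum_fiber; apply: eq_bigr => s _; rewrite /d /n mulr_suml -sumrB.
by apply: eq_bigr => x /andP[_ /eqP ->]; rewrite mulrBr.
Qed.

(** The contribution of [s] to [D2] is [d s - n s * y s]; it falls below [g s] only if [n s > 1],
    and then by at most [y s * eta s]. *)
Let D2_lower : \sum_(s in Q) g s - W%:R * EM <= D2.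
Proof.
have eQ : \sum_(s in Q) eta s <= EM.
  rewrite sumQ /EM [X in _ <= X](bigID (mem QD)) /=.
  rewrite (eq_bigl (fun x => (x \in darts M) && (x \in QD))) ?lerDl ?sumr_ge0 //.
  by move=> x; rewrite !inE; case: (x.1 \in M); rewrite ?andbT ?andbF.
apply: le_trans (_ : \sum_(s in Q) (g s - W%:R * eta s) <= _).
  by rewrite [X in _ <= X]sumrB lerD2l lerN2 -mulr_sumr ler_wpM2l.
rewrite D2E; apply: ler_sum => s sQ; rewrite /g.
have : (y s)%:R * (n s - 1) <= W%:R * eta s.
  have e0 := eta_ge0 s; have ns := n_le s.
  apply: le_trans (_ : (y s)%:R * eta s <= _); first by apply: ler_wpM2l => //; lra.
  by apply: ler_wpM2r => //; rewrite ler_nat Q_y.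
lra.
Qed.

Let c_ge : 1 / 2 <= c.
Proof.
have w1 := W1; rewrite /c; suff : 1 / (2 * W%:R) <= 1 / 2 :> R by lra.
rewrite ler_pdivrMr; last by lra.
by lra.
Qed.

Let cW : 1 / (2 * W%:R) = 1 - c.
Proof. by rewrite /c; lra. Qed.

(** Group the darts from [Q] by far end [t] and apply [cauchy_linearized]: the cover bounds the
    share of [D2] at [t] by the total [xi] times [y t], and dropping [y] at the sources bounds it by
    [d t]. *)
Let second_part : 2 * c * D2 - c ^+ 2 * Y <=
  \sum_(x in darts H' | src p x \in Q) xi * d (dst p x).
Proof.
have exch (F : E * bool -> R) : \sum_(x in darts H' | src p x \in Q) F x =
    \sum_t \sum_(x | (x \in darts H') && (src p x \in Q) && (dst p x == t)) F x.
  by rewrite -(sum_fiber (dst p) _ predT); apply: eq_bigl => x; rewrite andbT.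
rewrite /D2 !exch /Y !mulr_sumr -sumrB; apply: ler_sum => t _.
rewrite (eq_bigr (fun x => xi * d t) (F1 := fun x => xi * d (dst p x))); last first.
  by move=> x /andP[_ /eqP ->].
rewrite -mulr_suml; have c2 := c_ge; apply: cauchy_linearized => //.
- exact: sumr_ge0.
- by lra.
- rewrite mulr_suml; apply: ler_sum => x /andP[/andP[xH _] /eqP dx].
  apply: ler_wpM2l => //; rewrite lerBlDl -natrD ler_nat -dx.
  rewrite in_darts in xH; have := @cover x.1; rewrite inE xH => /(_ isT).
  by rewrite /src /dst; case: x.2 => //=; rewrite addnC.
- apply: le_trans (_ : \sum_(x in darts H' | dst p x == t) xi * (k x.1)%:R <= _); last first.
    by rewrite (sum_darts_rev H' (fun x => dst p x == t)) /d /dst /=; under eq_bigl => x do rewrite negbK.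
  rewrite [X in _ <= X](bigID (fun x => src p x \in Q)) /=.
  rewrite [X in _ <= X + _](eq_bigl (fun x => (x \in darts H') && (src p x \in Q) && (dst p x == t))); last first.
    by move=> x; rewrite andbAC.
  apply: ler_wpDr; first by apply: sumr_ge0 => x _; rewrite mulr_ge0 ?ler0n.
  by apply: ler_sum => x _; apply: ler_wpM2l => //; rewrite lerBlDr lerDl ler0n.
Qed.

(** This sums [upper] over the darts out of [Q], after subtracting [y] at the source from both
    sides. *)
Let pairs_upper : \sum_(s in Q) n s * g s + \sum_(x in darts H' | src p x \in Q) xi * d (dst p x)
  <= D2 + 2 * En.
Proof.
have nE (F : E * bool -> S) f : (forall s, 0 <= f s) -> 
    \sum_(x in darts H' | src p x \in Q) xi * f (F x) <= \sum_(x in darts H') xi * f (F x).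
  move=> f0; rewrite [X in _ <= X](bigID (fun x => src p x \in Q)) /= lerDl.
  by apply: sumr_ge0 => x _; rewrite mulr_ge0.
have Es : \sum_(x in darts H') xi * eta (src p x) = En.
  transitivity (\sum_(x in darts H' | predT (src p x)) xi * eta (src p x)).
    by apply: eq_bigl => x; rewrite andbT.
  rewrite sum_fiber; apply: eq_bigr => s _; rewrite /n mulr_suml.
  by apply: eq_bigr => x /andP[_ /eqP ->].
have Ed : \sum_(x in darts H') xi * eta (dst p x) = En.
  rewrite -Es; have := sum_darts_rev H' predT (fun x => xi * eta (src p x)).
  rewrite (eq_bigl (fun x => x \in darts H')) => [->|x]; last by rewrite andbT.
  by apply: eq_bigl => x; rewrite andbT.
have -> : \sum_(s in Q) n s * g s = \sum_(x in darts H' | src p x \in Q) xi * g (src p x).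
  rewrite sum_fiber; apply: eq_bigr => s _; rewrite /n mulr_suml.
  by apply: eq_bigr => x /andP[_ /eqP ->].
have h1 := nE _ _ eta_ge0; have := h1 (src p); have := h1 (dst p); rewrite Es Ed.
suff : \sum_(x in darts H' | src p x \in Q) xi * g (src p x) +
   \sum_(x in darts H' | src p x \in Q) xi * d (dst p x) <= D2 +
   \sum_(x in darts H' | src p x \in Q) xi * eta (src p x) +
   \sum_(x in darts H' | src p x \in Q) xi * eta (dst p x) by lra.
rewrite /D2 -!big_split /=; apply: ler_sum => x /andP[xH _].
rewrite -!mulrDr; apply: ler_wpM2l => //; have := upper xH; rewrite /g; lra.
Qed.

(** Since [1 / W%:R = 2 * (1 - c)], the bounds combine, up to errors, to [(1 - c) * Def + (2 * c -
    1) * Def <= c ^+ 2 * Y]. Hence [Def <= c * Y], and [1 + c] is the stated factor. *)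
Lemma dual_counting : \sum_(e in M) (k e)%:R <= (2 - 1 / (2 * W%:R)) * Y +
  2 * (lam * \sum_(e in M) (k e)%:R + (1 + W%:R) * EM + 2 * En).
Proof.
have EM0 : 0 <= EM by apply: sumr_ge0.
have En0 : 0 <= En by apply: sumr_ge0 => s _; rewrite mulr_ge0.
have E10 : 0 <= E1 by rewrite addr_ge0 ?mulr_ge0 ?sumr_ge0.
have WEM : 0 <= W%:R * EM by rewrite mulr_ge0.
have c2 := c_ge; have c1 : c <= 1.
  by rewrite /c lerBlDr lerDl divr_ge0 ?mulr_ge0 ?ler0n.
rewrite cW; set e := 2 * (_ + _); have eE : e = 2 * (E1 + W%:R * EM + 2 * En).
  by rewrite /e /E1 -/EM; lra.
have f1 := first_part; have f2 := second_part; have f3 := pairs_upper.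
have g1 := gain_lower; have g2 := D2_lower; have g3 := cardQ; have g4 := weight_le.
(* The loss [#|Q|%:R / 4] costs at most half of [Def], by [cardQ]. *)
have f1' : (Def / 2 - E1) / W%:R <= \sum_(s in Q) n s * g s.
  apply: le_trans f1; apply: ler_wpM2r; first by rewrite invr_ge0.
  lra.
have WV : W%:R^-1 = 2 * (1 - c).
  by rewrite -cW mul1r invfM mulrA mulfV ?mul1r // pnatr_eq0.
rewrite WV in f1'.
have g5 : (2 * c - 1) * (Def - E1 - W%:R * EM) <= (2 * c - 1) * D2.
  by apply: ler_wpM2l; lra.
have key : c * Def <= c * (c * Y + e).
  have q1 : 0 <= (2 * c - 1) * (2 * En) by rewrite mulr_ge0 //; lra.
  have q2 : 0 <= (2 * c - 1) * E1 by rewrite mulr_ge0 //; lra.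
  have q3 : 0 <= (1 - c) * E1 by rewrite mulr_ge0 //; lra.
  have q4 : 0 <= (1 - c) * (W%:R * EM) by rewrite mulr_ge0 //; lra.
  rewrite eE; nra.
have cp : 0 < c by lra.
rewrite (ler_pM2l cp) in key.
apply: le_trans g4 _; lra.
Qed.
End Counting.

(** * The case of unit capacities *)

Section UnitCapacity.
Variables (R : realFieldType) (S E : finType) (p : E -> bool -> S).
Variables (M H0 H1 : {set E}) (k : E -> nat) (W : nat) (eps lam B : R).

Let D s : R := \sum_(x in darts H0 | src p x == s) (k x.1)%:R.

Hypothesis eps_bounds : 0 < eps < 1 / 2.
Hypothesis W_gt0 : (0 < W)%N.
Hypothesis k_bounds : forall e, (1 <= k e <= W)%N.
Hypothesis mM : matching p M.
Hypothesis H1M : H1 \subset M.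
Hypothesis simpleH : {in darts H0 &, forall x y, src p x = src p y -> dst p x = dst p y -> x = y}.
Hypothesis touch : forall e, e \in H0 -> exists i x, x \in darts M /\ src p x = p e i.
Hypothesis lam_bounds : 0 <= lam <= eps / 100.
Hypothesis B_large : (130 * W%:R ^+ 2 / eps) ^+ 2 <= B.
Hypothesis upper : forall e, e \in H0 -> D (p e true) + D (p e false) <= B * (k e)%:R.
Hypothesis lower : forall e, e \in M :\: H1 ->
  (1 - lam) * B * (k e)%:R <= D (p e true) + D (p e false).

Let W1 : 1 <= W%:R :> R. Proof. by rewrite ler1n. Qed.
Let eps_gt0 : 0 < eps. Proof. by case/andP: eps_bounds. Qed.
Let B_gt0 : 0 < B.
Proof.
apply: lt_le_trans B_large; rewrite exprn_gt0 // divr_gt0 // mulr_gt0 // exprn_gt0 //.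
by rewrite ltr0n.
Qed.
Let D_ge0 s : 0 <= D s. Proof. exact: sumr_ge0. Qed.

(** Take for [m] the lightest weight at [s]: [upper] for that edge already bounds [D s]. A vertex
    without edges of [H0] gets the default 1. *)
Let min_weight s : exists m : nat, [/\ (1 <= m <= W)%N, D s <= B * m%:R &
  forall x, x \in darts H0 -> src p x = s -> (m <= k x.1)%N].
Proof.
case: (pickP (fun x => (x \in darts H0) && (src p x == s))) => [x0 x0P|none]; last first.
  exists 1%N; split; first by rewrite W_gt0.
    by rewrite mulr1 /D big_pred0 // ltW.
  by move=> x xH /eqP sx; have := none x; rewrite xH sx.
have [x /andP[xH /eqP sx] xmin] := @arg_minnP _ x0 (fun x => (x \in darts H0) && (src p x == s)) (fun x => k x.1) x0P.
exists (k x.1); split=> //; last by move=> z zH /eqP sz; apply: xmin; rewrite zH.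
have xH' : x.1 \in H0 by rewrite -in_darts.
apply: le_trans (upper xH'); rewrite -sx /src; case: x.2; rewrite ?lerDl ?lerDr; exact: D_ge0.
Qed.

Let nH s : R := \sum_(x in darts H0 | src p x == s) 1.
Let nM s : R := \sum_(x in darts M | src p x == s) 1.

Let sum_nM (f : S -> R) : \sum_s nM s * f s = \sum_(x in darts M) f (src p x).
Proof.
transitivity (\sum_(x in darts M | predT (src p x)) f (src p x)).
  rewrite sum_fiber; apply: eq_bigr => s _; rewrite mulr_suml.
  by apply: eq_bigr => x /andP[_ /eqP ->]; rewrite mul1r.
by apply: eq_bigl => x; rewrite andbT.
Qed.

Let sum_nH (f : S -> R) : \sum_s nH s * f s = \sum_(x in darts H0) f (src p x).
Proof.
transitivity (\sum_(x in darts H0 | predT (src p x)) f (src p x)).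
  rewrite sum_fiber; apply: eq_bigr => s _; rewrite mulr_suml.
  by apply: eq_bigr => x /andP[_ /eqP ->]; rewrite mul1r.
by apply: eq_bigl => x; rewrite andbT.
Qed.

Let nH_le s : nH s <= B.
Proof.
have [m [/andP[m1 _] Dm mk]] := min_weight s.
have m0 : 0 < m%:R :> R by rewrite ltr0n.
rewrite -(ler_pM2r m0); apply: le_trans Dm; rewrite mulr_suml.
by apply: ler_sum => x /andP[xH /eqP sx]; rewrite mul1r ler_nat mk.
Qed.

Let card2 (A : {set E}) : \sum_(x in darts A) 1 = 2 * #|A|%:R :> R.
Proof. by rewrite sum_darts sumr_const mulr_natr. Qed.

(** Every edge of [H0] meets one of the [2 * #|M|] ends of [M], and at most [B] edges of [H0] meet
    at a vertex. *)
Let card_H0 : #|H0|%:R <= 2 * B * #|M|%:R.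
Proof.
have nM0 s : 0 <= nM s by apply: sumr_ge0.
apply: le_trans (_ : \sum_(x in darts H0) nM (src p x) <= _).
  rewrite -sum1_card natr_sum sum_darts; apply: ler_sum => e /touch[i [x [xM sx]]].
  have : 1 <= nM (p e i).
    by rewrite /nM (bigD1 x) /= ?xM ?sx ?eqxx // lerDl sumr_ge0.
  have := nM0 (p e true); have := nM0 (p e false).
  by rewrite /src /=; case: i {sx} => /=; lra.
rewrite -sum_nH; under eq_bigr => s _ do rewrite mulrC.
rewrite sum_nM mulrAC -card2 mulr_suml; apply: ler_sum => x _.
by rewrite mul1r.
Qed.

(** The target size of [eta]; [B_large] says exactly that [B * tau ^+ 2] is at least [W%:R ^+ 2]. *)
Let tau : R := eps / (130 * W%:R).
Let tau_gt0 : 0 < tau.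
Proof. by rewrite divr_gt0 // mulr_gt0 // ltr0n. Qed.

Let B_tau : W%:R ^+ 2 <= B * tau ^+ 2.
Proof.
have W0 : W%:R != 0 :> R by rewrite pnatr_eq0 -lt0n.
have e0 : eps != 0 by rewrite gt_eqF.
have -> : W%:R ^+ 2 = (130 * W%:R ^+ 2 / eps) ^+ 2 * tau ^+ 2.
  by rewrite /tau; field; rewrite W0 e0.
by apply: ler_wpM2r => //; rewrite sqr_ge0.
Qed.

(** Up to the outer factor 2, this is the coefficient of [eta s] in the error of [dual_counting],
    with [n s] bounded by [2 / B * nH s]. *)
Let omega s : R := (1 + W%:R) * nM s + 4 / B * nH s.
Let omega_ge0 s : 0 <= omega s.
Proof. by rewrite addr_ge0 // mulr_ge0 ?divr_ge0 ?addr_ge0 ?sumr_ge0 // ltW. Qed.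

Let sum_omega : \sum_s omega s <= 20 * W%:R * #|M|%:R.
Proof.
have -> : \sum_s omega s = (1 + W%:R) * (2 * #|M|%:R) + 4 / B * (2 * #|H0|%:R).
  rewrite big_split /= -!mulr_sumr -!card2 -(sum_nM (fun=> 1)) -(sum_nH (fun=> 1)).
  by congr (_ * _ + _ * _); apply: eq_bigr => s _; rewrite mulr1.
have h : 4 / B * (2 * #|H0|%:R) <= 16 * #|M|%:R.
  rewrite mulrAC ler_pdivrMr //; have := card_H0; lra.
have : 0 <= (W%:R - 1) * #|M|%:R :> R by rewrite mulr_ge0 // subr_ge0.
by move: h; lra.
Qed.

(** * Errors for a fixed choice of sides *)

Section FixedSides.
Variable side : S -> bool.
Let chi s : R := (-1) ^+ side s.
Let Z s := \sum_(x in darts H0 | src p x == s) chi (dst p x) * (k x.1)%:R.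
Let eta s := `|Z s| / B.
Let H' := [set e in H0 | side (p e true) != side (p e false)].
Let d s : R := \sum_(x in darts H' | src p x == s) 2 / B * (k x.1)%:R.

Let in_H' x : (x \in darts H') = (x \in darts H0) && (side (src p x) != side (dst p x)).
Proof.
by rewrite !in_darts inE /src /dst; case: x.2; rewrite //= [in RHS]eq_sym.
Qed.

(** The indicator of crossing is half of one minus the product of the two signs; the half cancels
    the 2 in [2 / B]. *)
Let dE s : d s = (D s - chi s * Z s) / B.
Proof.
rewrite /d /D /Z (eq_bigl (fun x => ((x \in darts H0) && (src p x == s)) &&
  (side (src p x) != side (dst p x)))); last by move=> x; rewrite in_H' andbAC.
rewrite big_mkcondr mulr_sumr -sumrB mulr_suml; apply: eq_bigr => x /andP[_ /eqP <-].
rewrite mulrA /chi -signr_addb.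
by case: (side _); case: (side _); rewrite /= ?expr0 ?expr1; lra.
Qed.

Let d_close s : `|d s - D s / B| <= eta s.
Proof.
rewrite dE mulrBl addrAC subrr sub0r normrN normrM normrM /chi normr_sign mul1r.
by rewrite (@gtr0_norm _ B^-1) ?invr_gt0.
Qed.

Let eta_ge0 s : 0 <= eta s.
Proof. by rewrite divr_ge0 // ltW. Qed.

Lemma fixed_sides (y : S -> nat) :
  (forall e, e \in H' :|: H1 -> (k e <= y (p e true) + y (p e false))%N) ->
  \sum_(e in M) (k e)%:R <= (2 - 1 / (2 * W%:R)) * (\sum_s (y s)%:R) +
    2 * (lam * \sum_(e in M) (k e)%:R + \sum_s omega s * eta s).
Proof.
move=> cover; have iB : 0 < B^-1 by rewrite invr_gt0.
have xi0 : 0 <= 2 / B by rewrite divr_ge0 // ltW.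
have /andP[l0 _] := lam_bounds.
have dc s : d s - D s / B <= eta s /\ D s / B - d s <= eta s.
  by have := d_close s; rewrite ler_norml => /andP[h1 h2]; split=> //; lra.
have q (x : E * bool) : D (src p x) + D (dst p x) = D (p x.1 true) + D (p x.1 false).
  by rewrite /src /dst; case: x.2 => //=; rewrite addrC.
have BB a : B * a / B = a by rewrite mulrC mulKf // gt_eqF.
have nd s : \sum_(x in darts H' | src p x == s) (2 / B) <= 2 / B * nH s.
  rewrite /nH mulr_sumr [X in _ <= X](bigID (fun x => side (src p x) != side (dst p x))) /=.
  rewrite (eq_bigl (fun x => ((x \in darts H0) && (src p x == s)) &&
    (side (src p x) != side (dst p x)))); last by move=> x; rewrite in_H' andbAC.
  under eq_bigr => x _ do rewrite -[2 / B]mulr1.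
  by rewrite lerDl sumr_ge0 // => x _; rewrite mulr1.
apply: le_trans (@dual_counting R S E p M H' H1 k W (2 / B) lam y eta
  W_gt0 k_bounds mM xi0 l0 eta_ge0 _ _ _ cover) _.
- move=> x; rewrite in_H' => /andP[xH _]; rewrite -!/(d _).
  have := @upper x.1; rewrite -in_darts -q => /(_ xH).
  rewrite -(ler_pM2r iB) BB mulrDl.
  have [h1 _] := dc (src p x); have [h2 _] := dc (dst p x); lra.
(* With [m] the lightest weight at [s], [n * m <= d s <= D s / B + eta s <= m + eta s]; dividing by
   [m >= 1] gives [n <= 1 + eta s]. *)
- move=> s; have [m [/andP[m1 _] Dm mk]] := min_weight s.
  have m1' : 1 <= m%:R :> R by rewrite ler1n.
  set n := \sum_(x in _ | _) _.
  have nm : n * m%:R <= d s.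
    rewrite mulr_suml; apply: ler_sum => x /andP[]; rewrite in_H' => /andP[xH _] /eqP sx.
    by apply: ler_wpM2l => //; rewrite ler_nat mk.
  have [h1 _] := dc s; have := Dm; rewrite -(ler_pM2r iB) BB => h2.
  have : eta s <= eta s * m%:R by rewrite ler_peMr.
  have h3 : n * m%:R <= m%:R + eta s by lra.
  move=> h4; have m0 : 0 < m%:R :> R by lra.
  by rewrite -(ler_pM2r m0) mulrDl mul1r; lra.
- move=> e eM; rewrite -!/(d _); have := lower eM; rewrite -(ler_pM2r iB).
  have -> : (1 - lam) * B * (k e)%:R / B = (1 - lam) * (k e)%:R.
    by field; rewrite gt_eqF.
  rewrite mulrDl.
  have [_ h1] := dc (p e true); have [_ h2] := dc (p e false); lra.
rewrite lerD2l ler_pM2l // -addrA lerD2l.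
have -> : \sum_s omega s * eta s = (1 + W%:R) * \sum_(x in darts M) eta (src p x)
    + \sum_s (4 / B * nH s) * eta s.
  rewrite -sum_nM mulr_sumr -big_split /=; apply: eq_bigr => s _.
  by rewrite /omega mulrDl -(mulrA (1 + W%:R)).
rewrite lerD2l mulr_sumr; apply: ler_sum => s _; rewrite mulrA; apply: ler_wpM2r => //.
have := nd s; lra.
Qed.

(** The squared weights at [s] sum to at most [W%:R * D s <= B * W%:R ^+ 2 <= (B * tau) ^+ 2], so
    [eta] is at most [tau] in weighted quadratic mean; the inequality of means passes to the first
    moment. *)
Lemma eta_moment :
  \sum_s omega s * Z s ^+ 2 <= \sum_s omega s * \sum_(x in darts H0 | src p x == s) (k x.1)%:R ^+ 2 ->
  \sum_s omega s * eta s <= tau * (20 * W%:R * #|M|%:R).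
Proof.
move=> var.
have var' : \sum_s omega s * Z s ^+ 2 <= \sum_s omega s * (B * tau) ^+ 2.
  apply: le_trans var _; apply: ler_sum => s _; apply: ler_wpM2l => //.
  have [m [/andP[_ mW] Dm mk]] := min_weight s.
  apply: le_trans (_ : W%:R * D s <= _).
    rewrite /D mulr_sumr; apply: ler_sum => x _; rewrite expr2; apply: ler_wpM2r => //.
    by rewrite ler_nat; case/andP: (k_bounds x.1).
  apply: le_trans (_ : B * W%:R ^+ 2 <= _).
    have : D s <= B * W%:R by apply: le_trans Dm _; rewrite ler_pM2l // ler_nat.
    rewrite -(ler_pM2l (_ : 0 < W%:R)) ?ltr0n //; lra.
  by rewrite exprMn expr2 -mulrA ler_pM2l.
have amgm s : eta s <= (Z s ^+ 2 / (B ^+ 2 * tau) + tau) / 2.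
  have -> : Z s ^+ 2 / (B ^+ 2 * tau) = eta s ^+ 2 / tau.
    by rewrite /eta expr_div_n real_normK ?num_real // invfM mulrA.
  have t0 := tau_gt0; have : 0 <= (eta s - tau) ^+ 2 / tau.
    by rewrite divr_ge0 ?sqr_ge0 // ltW.
  have -> : (eta s - tau) ^+ 2 / tau = eta s ^+ 2 / tau + tau - 2 * eta s.
    by field; rewrite gt_eqF.
  lra.
apply: le_trans (_ : \sum_s omega s * ((Z s ^+ 2 / (B ^+ 2 * tau) + tau) / 2) <= _).
  by apply: ler_sum => s _; apply: ler_wpM2l.
have -> : \sum_s omega s * ((Z s ^+ 2 / (B ^+ 2 * tau) + tau) / 2) =
    ((\sum_s omega s * Z s ^+ 2) / (B ^+ 2 * tau) + (\sum_s omega s) * tau) / 2.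
  rewrite !mulr_suml -big_split mulr_suml; apply: eq_bigr => s _ /=; lra.
have h : (\sum_s omega s * Z s ^+ 2) / (B ^+ 2 * tau) <= (\sum_s omega s) * tau.
  rewrite ler_pdivrMr; last by rewrite mulr_gt0 ?exprn_gt0.
  apply: le_trans var' _; rewrite -mulr_suml exprMn le_eqVlt; apply/orP; left; apply/eqP; ring.
have : (\sum_s omega s) * tau <= 20 * W%:R * #|M|%:R * tau.
  by apply: ler_wpM2r => //; apply: ltW.
lra.
Qed.
End FixedSides.

(* The error terms add up to at most [(1 / 100 + 20 / 130) eps w(M)], which is
   below [eps w(M) / 6]; this is where the constant 130 comes from. *)
Lemma unit_capacity_matching : exists N : {set E},
  [/\ N \subset H0 :|: H1, matching p N &
    \sum_(e in M) (k e)%:R <= (2 - 1 / (2 * W%:R) + eps) * \sum_(e in N) (k e)%:R].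
Proof.
have [side [sM var]] := balanced_sides k mM simpleH omega_ge0.
pose H' := [set e in H0 | side (p e true) != side (p e false)].
(* Weight zero elsewhere confines the matching to [H' :|: H1], whose edges all cross: those of [H1]
   belong to [M]. *)
pose w e := if e \in H' :|: H1 then k e else 0%N.
have [|N [y [mN wN cov yN]]] := @egervary S E p side w.
  move=> e; rewrite /w; case: ifP => // /setUP[eH|/(subsetP H1M) eM] _; last exact: sM.
  by move: eH; rewrite inE => /andP[].
have NH e : e \in N -> e \in H' :|: H1 by move=> /wN; rewrite /w; case: ifP.
exists N; split=> //.
  by apply/subsetP => e /NH; rewrite !inE => /orP[/andP[-> _] // | ->]; rewrite orbT.
have /fixed_sides : forall e, e \in H' :|: H1 -> (k e <= y (p e true) + y (p e false))%N.
  by move=> e eH; have := cov e; rewrite /w eH.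
have := eta_moment var; set err := \sum_s omega s * _ => err_le.
set w_M := \sum_(e in M) _; set Y := \sum_s _ => key.
have YN : Y <= \sum_(e in N) (k e)%:R.
  rewrite /Y -!natr_sum ler_nat; apply: leq_trans yN _.
  by apply: leq_sum => e _; rewrite /w; case: ifP.
have M_w : #|M|%:R <= w_M.
  by rewrite -sum1_card natr_sum; apply: ler_sum => e _; rewrite ler_nat; case/andP: (k_bounds e).
have M0 : 0 <= #|M|%:R :> R by [].
have Y0 : 0 <= Y by apply: sumr_ge0.
have W0 : W%:R != 0 :> R by rewrite pnatr_eq0 -lt0n.
have tauE : tau * (20 * W%:R * #|M|%:R) = 2 / 13 * (eps * #|M|%:R).
  by rewrite /tau; field.
rewrite tauE in err_le.
have /andP[l0 l1] := lam_bounds; have /andP[e0 e1] := eps_bounds.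
have h1 : lam * w_M <= eps / 100 * w_M by apply: ler_wpM2r => //; apply: le_trans M_w.
have h2 : eps * #|M|%:R <= eps * w_M by rewrite ler_pM2l.
have h3 : 0 <= 1 / (2 * W%:R) :> R by rewrite divr_ge0 // mulr_ge0.
set a := 2 - _ in key *; have a2 : a <= 2 by rewrite /a; lra.
have a1 : 0 <= a.
  have : 1 / (2 * W%:R) <= 1 :> R by rewrite ler_pdivrMr; have := W1; lra.
  by rewrite /a; lra.
have h4 : (1 - eps / 3) * w_M <= a * Y.
  have : 0 <= eps * w_M by apply: mulr_ge0; [exact: ltW | exact: le_trans M0 M_w].
  lra.
(* Here [a <= (1 - eps / 3) * (a + eps)], because [a + eps <= 3]. *)
apply: le_trans (_ : (a + eps) * Y <= _); last by apply: ler_wpM2l => //; lra.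
have h5 : 0 < 1 - eps / 3 by lra.
rewrite -(ler_pM2l h5); apply: le_trans h4 _; rewrite mulrA; apply: ler_wpM2r => //.
have : 0 <= eps * (3 - a - eps) by apply: mulr_ge0; lra.
lra.
Qed.
End UnitCapacity.

(** * Balanced slots *)

Lemma injective_index (X C : finType) (A : {set X}) (cl : X -> C) :
  exists idx : X -> nat,
    (forall x, x \in A -> (idx x < #|[set y in A | cl y == cl x]|)%N) /\
    {in A &, forall x y, cl x = cl y -> idx x = idx y -> x = y}.
Proof.
pose fib c := [set y in A | cl y == c].
exists (fun x => index x (enum (fib (cl x)))); split=> [x xA|x y xA yA cxy].
  by rewrite cardE index_mem mem_enum inE xA eqxx.
rewrite cxy => /(index_inj x); apply; rewrite ?mem_enum //.
  by rewrite inE xA cxy eqxx.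
by rewrite inE yA eqxx.
Qed.

Lemma card_ord_lt (m n : nat) : (n <= m)%N -> #|[set i : 'I_m | (i < n)%N]| = n.
Proof.
move=> nm; rewrite -sum1_card (eq_bigl (fun i : 'I_m => (i < n)%N)) => [|i]; last by rewrite inE.
by rewrite -(big_ord_widen m (fun=> 1%N) nm) sum1_card card_ord.
Qed.

Section BalancedSlots.
Variables (X V U : finType) (A : {set X}) (cl1 : X -> V) (cl2 : X -> U).
Variables (b : V -> nat) (k : X -> nat) (W m : nat).
Hypothesis k_le : forall x, (k x <= W)%N.
Hypothesis b_le : forall v, (b v <= m.+1)%N.
Hypothesis fiber_le : forall v u, (#|[set x in A | (cl1 x == v) && (cl2 x == u)]| <= b v)%N.

Implicit Type f : {ffun X -> 'I_m.+1}.

(** In the application the items are darts, [cl1] and [cl2] are their source and far end, and [f] is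
    the slot at the source. *)
Let load f v i : nat := (\sum_(x in A | (cl1 x == v) && (f x == i)) k x)%N.
Let valid f := [forall x in A, (f x < b (cl1 x))%N] &&
  [forall x in A, forall y in A, (cl1 x == cl1 y) ==> (cl2 x == cl2 y) ==> (f x == f y) ==> (x == y)].
Let potential f : nat := (\sum_v \sum_i load f v i ^ 2)%N.

Let validP f : reflect ((forall x, x \in A -> (f x < b (cl1 x))%N) /\
   {in A &, forall x y, cl1 x = cl1 y -> cl2 x = cl2 y -> f x = f y -> x = y}) (valid f).
Proof.
apply: (iffP andP) => -[h1 h2]; split.
- by move=> x xA; move/forall_inP: h1; apply.
- move=> x y xA yA c1 c2 fxy; move/forall_inP: h2 => /(_ x xA) /forall_inP /(_ y yA).
  by rewrite c1 c2 fxy !eqxx => /eqP.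
- exact/forall_inP.
- apply/forall_inP => x xA; apply/forall_inP => y yA.
  by apply/implyP => /eqP c1; apply/implyP => /eqP c2; apply/implyP => /eqP fxy; apply/eqP/h2.
Qed.

Let exists_valid : exists f, valid f.
Proof.
have [idx [lt inj]] := injective_index A (fun x => (cl1 x, cl2 x)).
have lt' x : x \in A -> (idx x < b (cl1 x))%N.
  move=> xA; apply: leq_trans (lt x xA) _; apply: leq_trans (fiber_le (cl1 x) (cl2 x)).
  by apply: subset_leq_card; apply/subsetP => y; rewrite !inE xpair_eqE.
have inordE x : x \in A -> (inord (idx x) : 'I_m.+1) = idx x :> nat.
  by move=> xA; rewrite inordK // (leq_trans (lt' x xA)).
exists [ffun x => inord (idx x)]; apply/validP; split=> [x xA|x y xA yA c1 c2].
  by rewrite ffunE inordE // lt'.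
rewrite !ffunE => /(congr1 val); rewrite /= !inordE // => ii.
by apply: inj => //; rewrite c1 c2.
Qed.

(* Exchanging the contents of two slots within one class of parallel items
   strictly decreases the sum of the squared loads as long as the two loads
   differ by more than [W]. *)
Lemma balanced_slots : exists f : X -> 'I_m.+1,
  [/\ forall x, x \in A -> (f x < b (cl1 x))%N,
      {in A &, forall x y, cl1 x = cl1 y -> cl2 x = cl2 y -> f x = f y -> x = y}
    & forall v (i j : 'I_m.+1), (i < b v)%N -> (j < b v)%N ->
       (\sum_(x in A | (cl1 x == v) && (f x == i)) k x <=
        \sum_(x in A | (cl1 x == v) && (f x == j)) k x + W)%N].
Proof.
have [f0 v0] := exists_valid.
have [f /validP[lt inj] fmin] := @arg_minnP _ f0 valid potential v0.
exists f; split=> // v i j ib jb; rewrite leqNgt; apply/negP.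
rewrite -!/(load f v _) => gap.
pose c (g : {ffun X -> 'I_m.+1}) u l : nat :=
  (\sum_(x | [&& x \in A, cl1 x == v & g x == l] && (cl2 x == u)) k x)%N.
have loadE g l : load g v l = (\sum_u c g u l)%N.
  by rewrite /load (partition_big cl2 predT).
have [u cu] : exists u, (c f u j < c f u i)%N.
  apply/existsP; apply: contraT; rewrite negb_exists => /forallP h.
  have : (load f v i <= load f v j)%N.
    by rewrite !loadE; apply: leq_sum => u _; rewrite leqNgt h.
  by move=> /leq_trans /(_ (leq_addr W _)); rewrite leqNgt gap.
(* A valid placement puts at most one item of a class into a slot, so an exchange shifts a load of
   at most [W]. *)
have cW l : (c f u l <= W)%N.
  rewrite /c; case: (pickP (fun x => [&& x \in A, cl1 x == v & f x == l] && (cl2 x == u))) => [x xP|none].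
    rewrite (bigD1 x) //= big1 ?addn0 // => y /andP[/andP[/and3P[yA /eqP y1 /eqP fy] /eqP y2] nyx].
    case/andP: xP => /and3P[xA /eqP x1 /eqP fx] /eqP x2.
    by case/negP: nyx; apply/eqP/inj; rewrite ?x1 ?x2 ?fx.
  by rewrite big_pred0.
pose g := [ffun x => if (cl1 x == v) && (cl2 x == u) then tperm i j (f x) else f x].
have ltg x : x \in A -> (g x < b (cl1 x))%N.
  move=> xA; have := lt x xA; rewrite ffunE; case: ifP => // /andP[/eqP -> _].
  by case: tpermP.
have vg : valid g.
  apply/validP; split=> // x y xA yA c1 c2; rewrite !ffunE c1 c2.
  by case: ifP => _; [move/perm_inj|]; apply: inj.
have load_other v' l : v' != v -> load g v' l = load f v' l.
  move=> nv; apply: eq_bigl => x; rewrite ffunE; case: eqVneq => //= ->.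
  by rewrite (negPf nv).
have c_other u' l : u' != u -> c g u' l = c f u' l.
  move=> nu; apply: eq_bigl => x; rewrite ffunE; case: (eqVneq (cl2 x) u') => [->|]; rewrite ?andbF //.
  by rewrite (negPf nu) andbF.
have c_u l : c g u l = c f u (tperm i j l).
  apply: eq_bigl => x; rewrite ffunE; case: (cl1 x == v); case: (cl2 x == u); rewrite /= ?andbF ?andbT //.
  by rewrite -[X in _ == X](tpermK i j) (inj_eq perm_inj).
have loadg l : (load g v l + c f u l = load f v l + c f u (tperm i j l))%N.
  rewrite !loadE (bigD1 u) //= [X in (_ = X + _)%N](bigD1 u) //= c_u.
  rewrite (eq_bigr (fun u' => c f u' l)) => [|u' nu]; [by rewrite addnC addnA addnAC | exact: c_other].
have nij : i != j by apply: contraTneq gap => ->; rewrite -leqNgt leq_addr.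
have := fmin g vg; rewrite leqNgt => /negP; apply.
rewrite /potential (bigD1 v) //= [X in (_ < X)%N](bigD1 v) //=.
rewrite (eq_bigr (fun v' => \sum_l load f v' l ^ 2)%N) => [|v' nv]; last first.
  by apply: eq_bigr => l _; rewrite load_other.
rewrite ltn_add2r (bigD1 i) //= [X in (_ < X)%N](bigD1 i) //=.
rewrite (bigD1 j) 1?eq_sym //= [X in (_ < _ + X)%N](bigD1 j) 1?eq_sym //=.
rewrite (eq_bigr (fun l => load f v l ^ 2)%N) => [|l /andP[li lj]]; last first.
  have := loadg l; rewrite tpermD 1?eq_sym // => /eqP; rewrite eqn_add2r => /eqP -> //.
rewrite !addnA ltn_add2r.
have := loadg i; have := loadg j; rewrite tpermL tpermR; have := cW i.
move: gap cu; move: (load g v i) (load g v j) (load f v i) (load f v j) (c f u i) (c f u j).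
move=> gi gj Li Lj ci cj; clear => gap cu ciW e1 e2.
(* The exchange shifts [del], with [0 < del <= W]; as the gap exceeds [W], what remains in slot [i]
   is still above the old load of slot [j]. *)
have [del eci] : exists del, ci = (cj + del)%N by exists (ci - cj)%N; lia.
have -> : gj = (Lj + del)%N by lia.
have -> : Li = (gi + del)%N by lia.
have : (Lj < gi)%N by lia.
have : (0 < del)%N by lia.
rewrite -!mulnn; nia.
Qed.
End BalancedSlots.

(** * Relevant edges and weighted degrees *)

Section Multigraph.
Variables (V : finType) (G : wmultigraph V) (b : V -> nat).
Implicit Types (M N H : {set edge G}).

(** Among the [b]-matchings at least as heavy as [MG], take one with fewest edges outside [Gbar];
    such an edge could be traded for a parallel relevant edge that is no lighter. *)
Lemma relevant_max_matching (Gbar MG : {set edge G}) :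
  relevant_subgraph b Gbar -> max_weight_b_matching b MG ->
  exists M : {set edge G}, max_weight_b_matching b M /\ M \subset Gbar.
Proof.
move=> rel [bMG maxMG].
pose ok M := [forall v, #|incident M v| <= b v]%N && (total_weight MG <= total_weight M)%N.
have ok0 : ok MG by rewrite /ok leqnn andbT; apply/forallP.
have [M /andP[/forallP bM wM] Mmin] := @arg_minnP _ MG ok (fun M => #|M :\: Gbar|) ok0.
exists M; split; first by split=> // N /maxMG h; apply: leq_trans h wM.
apply/subsetP => e eM; apply: contraT => eG.
have /eqP/cards2P[u [v [uv ee]]] := card_ends e.
have [cG heavy] := rel u v; set Euv := edges_between G u v in cG heavy.
have eE : e \in Euv by rewrite inE ee.
have incE w f : f \in Euv -> (w \in ends f) = (w \in [set u; v]) by rewrite inE => /eqP ->.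
have ME : (#|M :&: Euv| <= minn (b u) (b v))%N.
  rewrite leq_min; apply/andP; split; [apply: leq_trans (bM u) | apply: leq_trans (bM v)];
  apply: subset_leq_card; apply/subsetP => f; rewrite !in_setI => /andP[fM fE];
  by rewrite inE fM incE // !inE eqxx ?orbT.
(* As [e] is irrelevant, there are [minn (b u) (b v)] relevant edges between [u] and [v]. If [M] had
   them all, [e] would be one too many for the capacities. *)
have [f fGM] : exists f, f \in (Gbar :&: Euv) :\: M.
  apply/set0Pn; rewrite setD_eq0; apply/negP => sub.
  have lt1 : (#|Gbar :&: Euv| < #|Euv|)%N.
    apply: proper_card; apply/properP; split; first exact: subsetIr.
    by exists e; rewrite // inE negb_and eG.
  have lt2 : (#|Gbar :&: Euv| < #|M :&: Euv|)%N.
    apply: proper_card; apply/properP; split; last by exists e; rewrite inE ?eM // negb_and eG.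
    by rewrite subsetI sub subsetIr.
  by move: lt1 lt2 ME; rewrite cG; lia.
move: fGM; rewrite !in_setD !in_setI => /andP[fM /andP[fG fE]].
have we : (weight e <= weight f)%N by apply: heavy; rewrite ?in_setI ?in_setD ?fG ?fE ?eG ?eE.
pose M' := f |: M :\ e.
have fMe : f \notin M :\ e by rewrite inE negb_and fM orbT.
have ok' : ok M'.
  apply/andP; split; last first.
    apply: leq_trans wM _; rewrite /total_weight (big_setD1 e) //= big_setU1 //=.
    by rewrite leq_add2r.
  apply/forallP => w; case: (boolP (w \in ends e)) => we'.
    have we2 : w \in ends f by rewrite incE // -ee.
    have eI : e \in incident M w by rewrite inE eM.
    apply: leq_trans (bM w); rewrite (cardsD1 e (incident M w)) eI add1n.
    apply: leq_trans (_ : #|f |: incident M w :\ e| <= _)%N.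
      apply: subset_leq_card; apply/subsetP => x; rewrite !inE.
      by case: eqP => //= _; case: eqP.
    by rewrite cardsU1; case: (_ \notin _).
  apply: leq_trans (bM w); apply: subset_leq_card; apply/subsetP => x; rewrite !inE.
  case: eqP => [->|_] /=; first by rewrite incE // -ee (negPf we').
  by case: eqP.
have := Mmin M' ok'; rewrite leqNgt => /negP[].
apply: proper_card; apply/properP; split; last first.
  by exists e; rewrite !inE ?eM ?eG ?eqxx //= orbF; apply: contraNneq fM => <-.
apply/subsetP => x; rewrite !inE; case: eqP => [->|_]; first by rewrite fG.
by case/andP=> -> /andP[_ ->].
Qed.

Lemma exists_ends : exists pv : edge G -> bool -> V, forall e,
  ends e = [set pv e true; pv e false] /\ pv e true != pv e false.
Proof.
suff /fin_all_exists[pv pvP] : forall e : edge G, exists q : V * V, ends e = [set q.1; q.2] /\ q.1 != q.2.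
  by exists (fun e i => if i then (pv e).1 else (pv e).2).
by move=> e; have /eqP/cards2P[u [v [uv ->]]] := card_ends e; exists (u, v).
Qed.

Section Orientation.
Variable pv : edge G -> bool -> V.
Hypothesis pvP : forall e, ends e = [set pv e true; pv e false] /\ pv e true != pv e false.

Lemma card_incident N v : #|incident N v| = #|[set x in darts N | src pv x == v]|.
Proof.
rewrite -(card_in_imset (f := fst) (D := [set x in darts N | src pv x == v])).
  apply: eq_card => e; apply/idP/imsetP.
    rewrite inE (proj1 (pvP e)) !inE => /andP[eN] /orP[] /eqP ->; [exists (e, true)|exists (e, false)] => //;
    by rewrite !inE eN /src eqxx.
  case=> x; rewrite !inE => /andP[xN /eqP <-] ->; rewrite xN (proj1 (pvP x.1)) !inE /src.
  by case: x.2; rewrite eqxx ?orbT.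
case=> [e i] [f j]; rewrite !inE /src /= => /andP[_ /eqP ei] /andP[_ /eqP fj] ef.
subst f; congr pair; apply/eqP; apply: contraT => nij.
have := proj2 (pvP e).
by case: i j ei fj nij => [] [] //= -> ->; rewrite eqxx.
Qed.

Lemma wdegE N v : wdeg N v = (\sum_(x in darts N | src pv x == v) weight x.1)%N.
Proof.
rewrite /wdeg /total_weight.
have -> : (\sum_(e in incident N v) weight e = \sum_(e in N) \sum_(i | pv e i == v) weight e)%N.
  rewrite (eq_bigl (fun e => (e \in N) && (v \in ends e))); last by move=> e; rewrite inE.
  rewrite big_mkcondr; apply: eq_bigr => e _; rewrite big_mkcond big_bool /=.
  have [-> ne] := pvP e; rewrite !inE ![v == _]eq_sym.
  case: (eqVneq (pv e true) v) ne => [->|_ _] /=; last by case: ifP.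
  by rewrite eq_sym => /negPf ->; rewrite addn0.
rewrite pair_big_dep; apply: eq_bigl => x; by rewrite in_darts.
Qed.
End Orientation.
End Multigraph.

(** From [ln B >= 1 - B^-1 >= 8 / 9] the ratio condition gives [B >= 20000 * (8 / 9) * (W%:R ^+ 2 /
    eps) ^+ 2], and [20000 * 8 / 9] exceeds [130 ^+ 2]. *)
Lemma log_ratio_large (R : realType) (eps B lam : R) (W : nat) :
  0 < eps -> (0 < W)%N -> 9 <= B -> lam = eps / (100 * W%:R) ->
  2 * W%:R ^+ 2 * lam ^- 2 <= B / ln B ->
  (130 * W%:R ^+ 2 / eps) ^+ 2 <= B.
Proof.
move=> e0 W0 B9 -> h; have Bp : 0 < B by lra.
have W0' : W%:R != 0 :> R by rewrite pnatr_eq0 -lt0n.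
have lnB : 8 / 9 <= ln B.
  have : ln (1 + (B^-1 - 1)) <= B^-1 - 1.
    have : 0 < B^-1 by rewrite invr_gt0.
    by move=> Bi; apply: le_ln1Dx; lra.
  rewrite addrC subrK lnV ?posrE // => h1.
  have : B^-1 <= 9^-1 by rewrite lef_pV2 ?posrE.
  lra.
have lp : 0 < ln B by lra.
have {}h : 2 * W%:R ^+ 2 * (eps / (100 * W%:R)) ^- 2 * ln B <= B.
  by rewrite -ler_pdivlMr.
have q0 : 0 <= (W%:R ^+ 2 / eps) ^+ 2 by rewrite sqr_ge0.
have eq1 : 2 * W%:R ^+ 2 * (eps / (100 * W%:R)) ^- 2 = 20000 * (W%:R ^+ 2 / eps) ^+ 2.
  by field; rewrite W0' gt_eqF.
rewrite eq1 in h; apply: le_trans h; rewrite -mulrA exprMn.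
have : (W%:R ^+ 2 / eps) ^+ 2 * (8 / 9) <= (W%:R ^+ 2 / eps) ^+ 2 * ln B by apply: ler_wpM2l.
move: q0; set q := (_ / _) ^+ 2; lra.
Qed.

(** * Assembling the slots *)

Section Slots.
Variables (R : realType) (eps lam : R) (W : nat) (beta betam : int).
Variables (V : finType) (G : wmultigraph V) (b : V -> nat) (Gbar H M : {set edge G}).
Hypothesis eps_bounds : 0 < eps < 1 / 2.
Hypothesis W_gt0 : (1 <= W)%N.
Hypothesis lam_bounds : 0 <= lam <= eps / 100.
Hypothesis B_large : (130 * W%:R ^+ 2 / eps) ^+ 2 <= beta%:~R + 6 * W%:R.
Hypothesis beta_gap : (1 - lam) * (beta%:~R + 6 * W%:R) <= betam%:~R - 6 * W%:R :> R.
Hypothesis k_bounds : forall e : edge G, (1 <= weight e <= W)%N.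
Hypothesis b_gt0 : forall v, (0 < b v)%N.
Hypothesis rel : relevant_subgraph b Gbar.
Hypothesis edcs : wb_edcs R b beta betam Gbar H.
Hypothesis maxM : max_weight_b_matching b M.
Hypothesis MG : M \subset Gbar.

Let H0 := H :\: M.
Let H1 := H :&: M.
Let m := (\max_v b v)%N.

Let b_le v : (b v <= m.+1)%N.
Proof. by apply: leqW; apply: leq_bigmax. Qed.

Let k_le (e : edge G) : (weight e <= W)%N. Proof. by case/andP: (k_bounds e). Qed.

Section Placed.
Variable pv : edge G -> bool -> V.
Hypothesis pvP : forall e, ends e = [set pv e true; pv e false] /\ pv e true != pv e false.
Variables (idxM : edge G * bool -> nat) (idxH : edge G * bool -> 'I_m.+1).
Hypothesis idxM_lt : forall x, x \in darts M -> (idxM x < b (src pv x))%N.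
Hypothesis idxM_inj : {in darts M &, forall x y, src pv x = src pv y -> idxM x = idxM y -> x = y}.
Hypothesis idxH_lt : forall x, x \in darts H0 -> (idxH x < b (src pv x))%N.
Hypothesis idxH_inj : {in darts H0 &, forall x y, src pv x = src pv y -> dst pv x = dst pv y ->
  idxH x = idxH y -> x = y}.
Let load v i := (\sum_(x in darts H0 | (src pv x == v) && (idxH x == i)) weight x.1)%N.
Hypothesis balanced : forall v (i j : 'I_m.+1), (i < b v)%N -> (j < b v)%N ->
  (load v i <= load v j + W)%N.

(** A slot of [v] is a pair [(v, i)] with [i < b v]. Edges of [M] and of [H0] are numbered
    independently, so they may share slots; edges of [H1] keep their numbers from [M]. *)
Let p e i : V * 'I_m.+1 :=
  (pv e i, if e \in M then inord (idxM (e, i)) else idxH (e, i)).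

Let pM x : x \in darts M -> src p x = (src pv x, inord (idxM x)).
Proof. by rewrite in_darts /src /p => ->; case: x. Qed.

Let pH x : x \in darts H0 -> src p x = (src pv x, idxH x).
Proof. by rewrite in_darts inE /src /p => /andP[/negPf -> _]; case: x. Qed.

Let slot_lt x : x \in darts (H0 :|: M) -> ((src p x).2 < b (src pv x))%N.
Proof.
rewrite in_darts => /setUP[]; rewrite -in_darts => xD.
  by rewrite pH //= idxH_lt.
by rewrite pM //= inordK ?idxM_lt // (leq_trans (idxM_lt xD)).
Qed.

Let mM : matching p M.
Proof.
move=> x y xM yM; rewrite !pM // => -[sxy /(congr1 val)] /=.
by rewrite !inordK ?(leq_trans (idxM_lt _)) //; apply: idxM_inj.
Qed.

Let simple : {in darts H0 &, forall x y, src p x = src p y -> dst p x = dst p y -> x = y}.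
Proof.
move=> x y xH yH; rewrite !pH // => -[sxy ixy] /(congr1 fst) /= dxy.
exact: idxH_inj.
Qed.

Let slots_card (N : {set edge G}) v : N \subset H0 :|: M -> matching p N -> (#|incident N v| <= b v)%N.
Proof.
move=> NHM mN; rewrite (card_incident pvP) -(card_ord_lt (b_le v)).
rewrite -(card_in_imset (f := fun x => (src p x).2) (D := [set x in darts N | src pv x == v])).
  apply: subset_leq_card; apply/subsetP => i /imsetP[x]; rewrite !inE => /andP[xN /eqP <-] ->.
  by apply: slot_lt; rewrite in_darts (subsetP NHM).
move=> x y; rewrite !inE => /andP[xN /eqP sx] /andP[yN /eqP sy] ixy.
apply: mN; rewrite ?in_darts //; rewrite [src p x]surjective_pairing [src p y]surjective_pairing ixy.
by congr pair; rewrite -[LHS]/(src pv x) -[RHS]/(src pv y) sx sy.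
Qed.

(** By maximality [e |: M] exceeds the capacity of an end [v] of [e]. So [M] saturates [v] and
    occupies all its slots, including that of [e]. *)
Let touch e : e \in H0 -> exists i x, x \in darts M /\ src p x = p e i.
Proof.
move=> eH; have /setDP[eHH eM] := eH.
have [bM wM] := maxM.
have : ~~ [forall v, #|incident (e |: M) v| <= b v]%N.
  apply/negP => /forallP /wM; rewrite /total_weight big_setU1 //= leqNgt.
  by case/negP; rewrite -[X in (X < _)%N]add0n ltn_add2r; case/andP: (k_bounds e).
rewrite negb_forall => /existsP[v]; rewrite -ltnNge => ltv.
have ve : v \in ends e.
  apply: contraLR ltv => nve; rewrite -leqNgt; apply: leq_trans (bM v).
  apply: subset_leq_card; apply/subsetP => f; rewrite !inE.
  by case: eqP => [->|] //=; rewrite (negPf nve).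
have full : #|[set x in darts M | src pv x == v]| = b v.
  apply/eqP; rewrite eqn_leq -(card_incident pvP) bM -ltnS /=.
  apply: leq_trans ltv _; rewrite -(add1n #|_|) -(cards1 e).
  apply: leq_trans (leq_card_setU _ _); apply: subset_leq_card; apply/subsetP => f.
  by rewrite !inE; case: eqP.
have [i vi] : exists i, v = pv e i.
  by move: ve; rewrite (proj1 (pvP e)) !inE => /orP[] /eqP ->; [exists true | exists false].
exists i; have eD : (e, i) \in darts H0 by rewrite in_darts.
pose im := [set (src p x).2 | x in [set x in darts M | src pv x == v]].
have cim : #|im| = b v.
  rewrite card_in_imset // => x y; rewrite [x \in _]inE [y \in _]inE => /andP[xM /eqP sx] /andP[yM /eqP sy] ixy.
  apply: mM => //; rewrite [src p x]surjective_pairing [src p y]surjective_pairing ixy.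
  by congr pair; rewrite -[LHS]/(src pv x) -[RHS]/(src pv y) sx sy.
have imE : im = [set j : 'I_m.+1 | (j < b v)%N].
  apply/eqP; rewrite eqEcard card_ord_lt // cim leqnn andbT.
  apply/subsetP => j /imsetP[x]; rewrite [x \in _]inE => /andP[xM /eqP sx] ->.
  rewrite inE -sx; apply: slot_lt; rewrite in_darts inE; apply/orP; right; by rewrite -in_darts.
have : (src p (e, i)).2 \in im.
  rewrite imE inE vi; apply: slot_lt; rewrite in_darts inE; apply/orP; left; by rewrite -in_darts.
case/imsetP=> x; rewrite [x \in _]inE => /andP[xM /eqP sx] ix; exists x; split=> //.
rewrite [src p x]surjective_pairing [p e i]surjective_pairing -ix; congr pair.
by rewrite -[LHS]/(src pv x) sx vi.
Qed.

Let D s : R := \sum_(x in darts H0 | src p x == s) (weight x.1)%:R.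

Let D_load s : D s = (load s.1 s.2)%:R.
Proof.
rewrite /D /load natr_sum; apply: eq_bigl => x; case: (boolP (x \in darts H0)) => //= xH.
by rewrite pH // -pair_eqE.
Qed.

(** Each load is within [W] of the average of [wdeg H0] over the slots; deleting from [H] the at
    most [b v] edges of [M] at [v] lowers this average by at most another [W]. *)
Let D_close x : x \in darts (H0 :|: M) ->
  (wdeg H (src pv x))%:R / (b (src pv x))%:R - 2 * W%:R <= D (src p x) /\
  D (src p x) <= (wdeg H (src pv x))%:R / (b (src pv x))%:R + W%:R.
Proof.
move=> xD; set v := src pv x.
have ltv : ((src p x).2 < b v)%N by apply: slot_lt.
have bv : 0 < (b v)%:R :> R by rewrite ltr0n.
have w0E : wdeg H0 v = (\sum_(i : 'I_m.+1 | (i < b v)%N) load v i)%N.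
  rewrite (wdegE pvP) (partition_big idxH (fun i : 'I_m.+1 => (i < b v)%N)) /=.
    by apply: eq_bigr => i _; apply: eq_bigl => z; rewrite andbA.
  by move=> z /andP[zH /eqP <-]; apply: idxH_lt.
have cst (a : nat) : (\sum_(i : 'I_m.+1 | (i < b v)%N) a)%N = (b v * a)%N.
  by rewrite -[in RHS](card_ord_lt (b_le v)) -sum_nat_const; apply: eq_bigl => i; rewrite inE.
have w1 : (wdeg H0 v <= b v * (load v (src p x).2 + W))%N.
  by rewrite w0E -cst; apply: leq_sum => i ib; apply: balanced.
have w2 : (b v * load v (src p x).2 <= wdeg H0 v + b v * W)%N.
  by rewrite w0E -!cst -big_split; apply: leq_sum => i ib; apply: balanced.
have w3 : (wdeg H0 v <= wdeg H v)%N.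
  rewrite /wdeg /total_weight [X in (_ <= X)%N](big_setID (incident H0 v)) /=.
  rewrite (setIidPr _) ?leq_addr //; apply/subsetP => e.
  by rewrite !inE => /andP[/andP[_ ->] ->].
have w4 : (wdeg H v <= wdeg H0 v + b v * W)%N.
  rewrite /wdeg /total_weight (big_setID (incident H0 v)) /=; apply: leq_add.
    rewrite (setIidPr _) //; apply/subsetP => e.
    by rewrite !inE => /andP[/andP[_ ->] ->].
  apply: leq_trans (_ : #|incident M v| * W <= _)%N; last by rewrite leq_mul2r (proj1 maxM) orbT.
  rewrite -sum_nat_const [X in (_ <= X)%N](big_setID (incident H v :\: incident H0 v)) /=.
  apply: leq_trans (leq_addr _ _); rewrite (setIidPr _); first by apply: leq_sum.
  apply/subsetP => e; rewrite !inE negb_and negb_and negbK.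
  by case: (e \in M); case: (e \in H); case: (v \in ends e).
have -> : D (src p x) = (load v (src p x).2)%:R by rewrite D_load.
move: w1 w2 w3 w4; rewrite -!(ler_nat R) !(natrD, natrM).
move: (load _ _)%:R => L w1 w2 w3 w4; split.
  rewrite lerBlDr ler_pdivrMr //; lra.
rewrite -lerBlDr ler_pdivlMr //; lra.
Qed.

Let upper e : e \in H0 ->
  D (p e true) + D (p e false) <= (beta%:~R + 6 * W%:R) * (weight e)%:R.
Proof.
move=> eH; have /setDP[eHH _] := eH; have [_ up _] := edcs.
have := up e _ _ eHH (proj1 (pvP e)).
have inD i : (e, i) \in darts (H0 :|: M) by rewrite in_darts inE eH.
have [_] := D_close (inD true); have [_] := D_close (inD false); rewrite /src /=.
have W0 : 0 <= W%:R :> R by [].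
have : W%:R <= W%:R * (weight e)%:R :> R by rewrite ler_peMr // ler1n; case/andP: (k_bounds e).
lra.
Qed.

(** Two slots lose at most [4 * W%:R], which is at most [6 * W%:R * (weight e)%:R] as weights are at
    least one. *)
Let lower e : e \in M :\: H1 ->
  (1 - lam) * (beta%:~R + 6 * W%:R) * (weight e)%:R <= D (p e true) + D (p e false).
Proof.
move=> /setDP[eM]; rewrite inE eM andbT => eH; have [_ _ low] := edcs.
have eGH : e \in Gbar :\: H by rewrite inE eH (subsetP MG).
have := low e _ _ eGH (proj1 (pvP e)).
have inD i : (e, i) \in darts (H0 :|: M) by rewrite in_darts inE eM orbT.
have [+ _] := D_close (inD true); have [+ _] := D_close (inD false); rewrite /src /=.
have W0 : 0 <= W%:R :> R by [].
have : W%:R <= W%:R * (weight e)%:R :> R by rewrite ler_peMr // ler1n; case/andP: (k_bounds e).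
have : (1 - lam) * (beta%:~R + 6 * W%:R) * (weight e)%:R <= (betam%:~R - 6 * W%:R) * (weight e)%:R.
  by apply: ler_wpM2r.
lra.
Qed.

Lemma placed_matching : exists N : {set edge G},
  [/\ N \subset H, b_matching b N &
    (total_weight M)%:R <= (2 - 1 / (2 * W%:R) + eps) * (total_weight N)%:R].
Proof.
have [N [NH mN wN]] := @unit_capacity_matching R _ _ p M H0 H1 (fun e => weight e) W eps lam _
  eps_bounds W_gt0 k_bounds mM (subsetIr _ _) simple touch lam_bounds B_large upper lower.
exists N; split.
- by apply: subset_trans NH _; rewrite subUset subsetDl subsetIl.
- move=> v; apply: slots_card => //; apply: subset_trans NH _.
  by apply: setUS; apply: subsetIr.
- by rewrite /total_weight !natr_sum.
Qed.
End Placed.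

Lemma edcs_contains_matching : exists N : {set edge G},
  [/\ N \subset H, b_matching b N &
    (total_weight M)%:R <= (2 - 1 / (2 * W%:R) + eps) * (total_weight N)%:R].
Proof.
have [pv pvP] := exists_ends G.
have [idxM [ltM injM]] := injective_index (darts M) (src pv).
(* Relevance leaves at most [b v] parallel edges, so they fit into distinct slots of [v]. *)
have parallel_le v u : (#|[set x in darts H0 | (src pv x == v) && (dst pv x == u)]| <= b v)%N.
  have [cG _] := rel v u; have [HG _ _] := edcs.
  apply: leq_trans (_ : #|Gbar :&: edges_between G v u| <= _)%N; last first.
    by rewrite cG; apply: leq_trans (geq_minl _ _) (geq_minl _ _).
  rewrite -(card_in_imset (f := fst) (D := [set x in darts H0 | (src pv x == v) && (dst pv x == u)])).
    apply: subset_leq_card; apply/subsetP => e /imsetP[x].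
    rewrite !inE => /andP[/andP[_ xH] /andP[/eqP <- /eqP <-]] ->.
    rewrite (subsetP HG) //= (proj1 (pvP x.1)) /src /dst.
    by case: x.2 => //=; rewrite setUC.
  case=> [e i] [f j]; rewrite !inE /src /= => /andP[_ /andP[/eqP ei _]] /andP[_ /andP[/eqP fj _]] ef.
  subst f; congr pair; have := proj2 (pvP e).
  by case: i j ei fj => [] [] //= -> ->; rewrite eqxx.
have [idxH [ltH injH bal]] :=
  balanced_slots (fun x : edge G * bool => k_le x.1) b_le parallel_le.
apply: (placed_matching pvP _ injM ltH injH bal) => x xM.
apply: leq_trans (ltM x xM) _.
by rewrite -(card_incident pvP); case: maxM.
Qed.
End Slots.

Theorem theorem34 (R : realType) (eps : R) (W : nat) (beta betam : int)
  (V : finType) (G : wmultigraph V) (b : V -> nat)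
  (Gbar H MG : {set edge G}) :
  0 < eps < 1 / 2 ->
  (1 <= W)%N ->
  let lambda : R := eps / (100 * W%:R) in
  betam + 2 <= beta ->
  3 <= beta ->
  (beta%:~R + 6 * W%:R) / ln (beta%:~R + 6 * W%:R)
    >= 2 * W%:R ^+ 2 * lambda ^- 2 :> R ->
  betam%:~R - 6 * W%:R >= (1 - lambda) * (beta%:~R + 6 * W%:R) :> R ->
  (forall e : edge G, 1 <= weight e <= W)%N ->
  (forall v : V, 0 < b v)%N ->
  relevant_subgraph b Gbar ->
  wb_edcs R b beta betam Gbar H ->
  max_weight_b_matching b MG ->
  exists MH : {set edge G},
    [/\ MH \subset H,
        b_matching b MH
      & (2 - 1 / (2 * W%:R) + eps) * (total_weight MH)%:R
          >= (total_weight MG)%:R :> R].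
Proof.
move=> eps_bounds W1 lambda _ beta3 logB gap k_bounds b0 rel edcs maxMG.
have /andP[e0 _] := eps_bounds.
have W1' : 1 <= W%:R :> R by rewrite ler1n.
have B9 : 9 <= beta%:~R + 6 * W%:R :> R.
  have : 3 <= beta%:~R :> R by rewrite (ler_int R 3 beta).
  lra.
have lam_bounds : 0 <= lambda <= eps / 100.
  have W100 : 100 <= 100 * W%:R :> R by lra.
  rewrite /lambda; apply/andP; split; first by apply: divr_ge0; lra.
  by apply: ler_wpM2l; [exact: ltW | rewrite lef_pV2 ?posrE; lra].
(* [MG] may use irrelevant edges, so it is replaced by a maximum [b]-matching inside [Gbar]. *)
have [M [maxM MGbar]] := relevant_max_matching rel maxMG.
have B_large := log_ratio_large e0 W1 B9 (erefl lambda) logB.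
have [N [NH bN wN]] := edcs_contains_matching eps_bounds W1 lam_bounds B_large gap
  k_bounds b0 rel edcs maxM MGbar.
exists N; split=> //; apply: le_trans wN; rewrite ler_nat.
by case: maxM => _; apply; case: maxMG.
Qed.
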